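(* Let $\sum_{k=1}^\infty x_k$ be a series of real numbers such that $\lim_{n\to\infty}\sum_{k=1}^{2n}x_k=a\in\mathbb{R}$. Then $SR_2(\sum x_k)$ is one of the following: (1) a shifted additive subgroup of the form $$a+\Big\{c_1z_1+\cdots+c_lz_l \;\Big|\; l\in\mathbb{N},\ z_k\in E,\ c_k\in\mathbb{Z},\ \sum_{k=1}^l c_k\text{ is even}\Big\},$$ where $E\subset\mathbb{R}$ is an $\varepsilon$-separated set for some $\varepsilon>0$; (2) the whole $\mathbb{R}$; (3) the one-point set $\{a\}$.
   Context: The 2n sum range $SR_2(\sum x_k)$ of a real series $\sum x_k$ is the set of all $s\in\mathbb{R}$ for which there is a permutation $\pi:\mathbb{N}\to\mathbb{N}$ such that $\lim_{n\to\infty}\sum_{k=1}^{2n}x_{\pi(k)}=s$. A set $E\subset\mathbb{R}$ is $\varepsilon$-separated if all pairwise distances between distinct elements of $E$ are greater than $\varepsilon$. *)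

(* Defs.v *)
From mathcomp Require Import all_boot all_order all_algebra.
From mathcomp Require Import all_classical all_reals all_analysis.
Set Implicit Arguments.
Unset Strict Implicit.
Unset Printing Implicit Defensive.
Import Order.TTheory GRing.Theory Num.Theory.
Import numFieldNormedType.Exports.
Local Open Scope classical_set_scope.
Local Open Scope ring_scope.

(* Series are indexed from 0: x 0, x 1, ... are the terms x_1, x_2, ... *)
Definition sum_2n (R : realType) (x : nat -> R) (n : nat) : R :=
  \sum_(0 <= k < 2 * n) x k.

Definition SR2 (R : realType) (x : nat -> R) : set R :=
  [set s | exists2 p : nat -> nat,
     bijective p & sum_2n (x \o p) n @[n --> \oo] --> s].

Definition eps_separated (R : realType) (eps : R) (E : set R) : Prop :=
  forall y z, E y -> E z -> y != z -> eps < `|y - z|.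

Definition even_combinations (R : realType) (E : set R) : set R :=
  [set s | exists (l : nat) (z : 'I_l -> R) (c : 'I_l -> int),
     [/\ (0 < l)%N,
         forall k, E (z k),
         (2 %| \sum_(k < l) c k)%Z &
         s = \sum_(k < l) (c k)%:~R * z k]].

(* Main.v *)
Require Import Defs.
From mathcomp Require Import all_boot all_order all_algebra.
From mathcomp Require Import all_classical all_reals all_analysis.
From mathcomp Require Import zify ring lra.
Set Implicit Arguments.
Unset Strict Implicit.
Unset Printing Implicit Defensive.
Import Order.TTheory GRing.Theory Num.Theory.
Import numFieldNormedType.Exports.
Local Open Scope classical_set_scope.
Local Open Scope ring_scope.

(** Write [u n], [v n] for the two terms of the [n]-th pair, ordered so that
    [v n <= u n], and [y n = u n + v n], a null sequence whose series converges
    to [a].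

    If the series of [y] is not absolutely convergent, permuting the pairs and
    Riemann's theorem give every sum. Otherwise, suppose that arbitrarily far
    out there are finite involutions [f] with all [|u n - u (f n)|] small but
    with total variation bounded below. Gluing them into one involution [t] and
    re-pairing [u n] with [v (t n)] gives null pair sums that are not absolutely
    summable, and Riemann's theorem again gives every sum.

    If such involutions do not exist, the tail of [u] splits into small classes
    at a positive distance from each other, and medians of these classes are
    separated centres [C n] with [\sum |u n - C n|] finite. Let [E] be the set
    of centres occurring infinitely often. In a rearrangement with convergent
    even sums, all but finitely many pairs cancel at the level of centres, and
    the classes that are finite are eventually exhausted, so the sum moves by an
    even combination of elements of [E]. Conversely a shift along an infinite
    class inserts one copy of [g] or [- g], for any [g] in [E]. *)

(** * Limits, permutations and pair sums *)

Lemma cvg_epsP {R : realType} (u : nat -> R) (l : R) :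
  (u n @[n --> \oo] --> l) <->
  (forall e : R, 0 < e -> exists N, forall n, (N <= n)%N -> `|u n - l| < e).
Proof.
split.
  move=> /cvgrPdist_lt H e e0; have [N _ HN] := H e e0.
  by exists N => n Nn; rewrite distrC; apply: HN.
move=> H; apply/cvgrPdist_lt => e e0; have [N HN] := H e e0.
by exists N => // n Nn; rewrite distrC; apply: HN.
Qed.

Lemma bijective_inj_surj (p : nat -> nat) :
  injective p -> (forall n, exists m, p m = n) -> bijective p.
Proof.
move=> inj /choice[g gK]; exists g => // n; exact/inj/gK.
Qed.

Lemma bijective_ge (p : nat -> nat) (K : nat) :
  bijective p -> exists N, forall n, (N <= n)%N -> (K <= p n)%N.
Proof.
move=> [g pK gK]; exists (\max_(k < K) (g k).+1)%N => n le_n.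
rewrite leqNgt; apply/negP => lt_pn.
have := leq_bigmax (F := fun k : 'I_K => (g k).+1) (Ordinal lt_pn).
by rewrite /= pK => /leq_trans /(_ le_n); rewrite ltnn.
Qed.

Lemma sum_2nE {R : realType} (x : nat -> R) n :
  sum_2n x n = \sum_(0 <= i < n) (x i.*2 + x i.*2.+1).
Proof.
rewrite /sum_2n mul2n; elim: n => [|n IH]; first by rewrite !big_geq.
by rewrite doubleS !big_nat_recr //= IH addrA.
Qed.

Lemma SR2_comp {R : realType} (x : nat -> R) (p : nat -> nat) :
  bijective p -> SR2 (x \o p) = SR2 x.
Proof.
move=> bp; apply/seteqP; split => s /= [q bq qs].
  by exists (p \o q) => //; exact: bij_comp.
have [g pK gK] := bp; exists (g \o q).
  by apply: bij_comp => //; exists p.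
rewrite (_ : (x \o p) \o (g \o q) = x \o q) //.
by apply/funext => n /=; rewrite gK.
Qed.

(** With [pe = po] whole pairs are permuted; with [pe] the identity each first term keeps its place
    and receives a new partner. *)
Definition pair_perm (pe po : nat -> nat) (k : nat) : nat :=
  if odd k then (po k./2).*2.+1 else (pe k./2).*2.

Lemma pair_perm_even pe po n : pair_perm pe po n.*2 = (pe n).*2.
Proof. by rewrite /pair_perm odd_double doubleK. Qed.

Lemma pair_perm_odd pe po n : pair_perm pe po n.*2.+1 = (po n).*2.+1.
Proof. by rewrite /pair_perm /= odd_double /= uphalf_double. Qed.

Lemma pair_perm_bij pe po :
  bijective pe -> bijective po -> bijective (pair_perm pe po).
Proof.
have can e e' o o' : cancel e e' -> cancel o o' ->
    cancel (pair_perm e o) (pair_perm e' o').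
  move=> eK oK k; rewrite -[k]odd_double_half; case: (odd k).
    by rewrite add1n !pair_perm_odd oK.
  by rewrite add0n !pair_perm_even eK.
by move=> [pe' ? ?] [po' ? ?]; exists (pair_perm pe' po'); apply: can.
Qed.

Lemma SR2_setT {R : realType} (x : nat -> R) :
  (forall s : R, exists2 p : nat -> nat, bijective p &
     (\sum_(0 <= k < n) (x (p k).*2 + x (p k).*2.+1)) @[n --> \oo] --> s) ->
  SR2 x = setT.
Proof.
move=> H; apply/seteqP; split => // s _; have [p bp ps] := H s.
exists (pair_perm p p); first exact: pair_perm_bij.
apply: cvg_trans ps; apply: near_eq_cvg; near=> n.
rewrite sum_2nE; apply: eq_bigr => i _ /=.
by rewrite pair_perm_even pair_perm_odd.
Unshelve. all: by end_near. Qed.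

(** * Enumeration of an infinite set of indices *)

Section NextIn.
Variables (P : pred nat) (infP : forall M, exists n, (M <= n)%N && P n).

Definition next_in (n : nat) : nat := ex_minn (infP n).

Lemma next_in_ge n : (n <= next_in n)%N.
Proof. by rewrite /next_in; case: ex_minnP => m /andP[]. Qed.

Lemma next_inP n : P (next_in n).
Proof. by rewrite /next_in; case: ex_minnP => m /andP[]. Qed.

Lemma next_in_min n m : (n <= m)%N -> P m -> (next_in n <= m)%N.
Proof.
by rewrite /next_in; case: ex_minnP => k _ kmin nm Pm; apply: kmin; rewrite nm.
Qed.

Lemma next_in_id n : P n -> next_in n = n.
Proof.
by move=> Pn; apply/eqP; rewrite eqn_leq next_in_ge next_in_min.
Qed.

Lemma next_in_notin n : ~~ P n -> next_in n = next_in n.+1.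
Proof.
move=> nPn; have ltn : (n < next_in n)%N.
  rewrite ltn_neqAle next_in_ge andbT; apply: contra nPn => /eqP ->.
  exact: next_inP.
apply/eqP; rewrite eqn_leq !next_in_min ?next_inP //.
exact: ltnW (next_in_ge _).
Qed.

Fixpoint enum_in (i : nat) : nat :=
  if i is i'.+1 then next_in (enum_in i').+1 else next_in 0.

Lemma enum_inP i : P (enum_in i).
Proof. by case: i => [|i]; exact: next_inP. Qed.

Lemma enum_in_lt i j : (i < j)%N -> (enum_in i < enum_in j)%N.
Proof.
elim: j => // j IH; rewrite ltnS leq_eqVlt => /orP[/eqP->|/IH] /=.
  exact: next_in_ge.
by move=> /ltn_trans; apply; exact: next_in_ge.
Qed.

Lemma enum_in_inj : injective enum_in.
Proof.
move=> i j eij; case: (ltngtP i j) => // /enum_in_lt; by rewrite eij ltnn.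
Qed.

(** Here [J] is the number of elements of [P] below [M]. A filtered sum thus becomes an initial sum
    along the enumeration. *)
Lemma next_in_enum {V : nmodType} (F : nat -> V) M : exists J,
  next_in M = enum_in J /\
  \sum_(0 <= n < M | P n) F n = \sum_(0 <= b < J) F (enum_in b).
Proof.
elim: M => [|M [J [eM eS]]]; first by exists 0; split => //; rewrite !big_geq.
have [PM|nPM] := boolP (P M).
  have eMJ : M = enum_in J by rewrite -eM next_in_id.
  exists J.+1; split; first by rewrite /= -eMJ.
  by rewrite big_mkcond big_nat_recr //= -big_mkcond /= eS PM big_nat_recr //= -eMJ.
exists J; split; first by rewrite -next_in_notin.
by rewrite big_mkcond big_nat_recr //= -big_mkcond /= eS (negbTE nPM) addr0.
Qed.

Lemma enum_in_surj n : P n -> exists i, enum_in i = n.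
Proof.
move=> Pn; have [J [eJ _]] := next_in_enum (fun=> 0%N) n.
by exists J; rewrite -eJ next_in_id.
Qed.

End NextIn.

(** * Riemann's rearrangement theorem *)

Section Riemann.
Context {R : realType}.
Variable y : nat -> R.
Hypothesis y_null : forall e : R, 0 < e -> exists N, forall n, (N <= n)%N -> `|y n| < e.
Hypothesis y_pos : forall L : R, exists M, L <= \sum_(0 <= n < M | 0 <= y n) y n.
Hypothesis y_neg : forall L : R, exists M, \sum_(0 <= n < M | ~~ (0 <= y n)) y n <= L.

(** If no nonnegative term occurred from [M] on, the nonnegative partial sums would never exceed the
    one at [M]. *)
Let pos_inf M : exists n, (M <= n)%N && (0 <= y n).
Proof.
apply: contrapT => /forallNP H.
have [M' HM'] := y_pos (\sum_(0 <= n < M | 0 <= y n) y n + 1).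
have := HM'; apply/negP; rewrite -ltNge.
have [le_M|/ltnW le_M] := leqP M' M.
  rewrite (@big_cat_nat _ _ _ M' 0 M) //= ltr_pwDr // lerDl.
  by apply: sumr_ge0.
rewrite (@big_cat_nat _ _ _ M 0 M') //= [X in _ + X < _]big_nat_cond.
rewrite [X in _ + X < _]big1 ?addr0 ?ltrDl //.
by move=> i /andP[/andP[Mi _] yi]; case: (H i); rewrite Mi yi.
Qed.

Let neg_inf M : exists n, (M <= n)%N && ~~ (0 <= y n).
Proof.
apply: contrapT => /forallNP H.
have [M' HM'] := y_neg (\sum_(0 <= n < M | ~~ (0 <= y n)) y n - 1).
have := HM'; apply/negP; rewrite -ltNge.
have [le_M|/ltnW le_M] := leqP M' M.
  rewrite (@big_cat_nat _ _ _ M' 0 M) //= -addrA gtrDl -opprB oppr_lt0 subr_gt0.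
  apply: le_lt_trans (ltr01); apply: sumr_le0 => i.
  by rewrite -ltNge => /ltW.
rewrite (@big_cat_nat _ _ _ M 0 M') //= [X in _ < _ + X]big_nat_cond.
rewrite [X in _ < _ + X]big1 ?addr0 ?gtrBl //.
by move=> i /andP[/andP[Mi _] yi]; case: (H i); rewrite Mi yi.
Qed.

Let al := enum_in pos_inf.
Let be := enum_in neg_inf.

Variable s : R.

Let psum (ij : nat * nat) : R :=
  \sum_(0 <= i < ij.1) y (al i) + \sum_(0 <= j < ij.2) y (be j).

(** The two counters are the numbers of nonnegative and of negative terms already used; each step
    moves the sum towards [s] or past it. *)
Fixpoint greedy_state (n : nat) : nat * nat :=
  if n is n'.+1 then
    let ij := greedy_state n' in
    if psum ij <= s then (ij.1.+1, ij.2) else (ij.1, ij.2.+1)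
  else (0%N, 0%N).

Let S n := psum (greedy_state n).

Definition greedy_perm (n : nat) : nat :=
  let ij := greedy_state n in if psum ij <= s then al ij.1 else be ij.2.

Let al_ge0 i : 0 <= y (al i). Proof. exact: (enum_inP pos_inf). Qed.
Let be_lt0 i : y (be i) < 0.
Proof. by have := enum_inP neg_inf i; rewrite -ltNge. Qed.

Let greedyS n : greedy_state n.+1 =
  if S n <= s then ((greedy_state n).1.+1, (greedy_state n).2)
  else ((greedy_state n).1, (greedy_state n).2.+1).
Proof. by []. Qed.

Let SS n : S n.+1 = S n + y (greedy_perm n).
Proof.
rewrite {1}/S greedyS /greedy_perm -/(S n).
case: ifP => _; rewrite /psum /= big_nat_recr //= /S /psum; lra.
Qed.

Lemma greedy_sum n : \sum_(0 <= k < n) y (greedy_perm k) = S n.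
Proof.
elim: n => [|n IH]; last by rewrite big_nat_recr //= IH SS.
by rewrite big_geq // /S /psum /= !big_geq // addr0.
Qed.

Let st1_le m n : (m <= n)%N -> ((greedy_state m).1 <= (greedy_state n).1)%N.
Proof.
move=> /subnK <-; elim: (n - m)%N => // k IH; apply: leq_trans IH _.
by rewrite addSn greedyS; case: ifP.
Qed.

Let st2_le m n : (m <= n)%N -> ((greedy_state m).2 <= (greedy_state n).2)%N.
Proof.
move=> /subnK <-; elim: (n - m)%N => // k IH; apply: leq_trans IH _.
by rewrite addSn greedyS; case: ifP.
Qed.

(** Sums staying above [s] would use negative terms only, and those have sums unbounded below. *)
Let below_again n : exists m, (n <= m)%N && (S m <= s).
Proof.
apply: contrapT => /forallNP H.
have Hgt m : (n <= m)%N -> (S m <= s) = false.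
  by move=> nm; apply/negP => Hm; case: (H m); rewrite nm.
have stE t : greedy_state (n + t) = ((greedy_state n).1, ((greedy_state n).2 + t)%N).
  elim: t => [|t IH]; first by rewrite !addn0; case: (greedy_state n).
  by rewrite addnS greedyS Hgt ?leq_addr // IH /= addnS.
have [M HM] := y_neg (s - \sum_(0 <= i < (greedy_state n).1) y (al i)).
have [J [_ EJ]] := next_in_enum neg_inf y M.
have := Hgt (n + J)%N (leq_addr _ _); rewrite /S stE /psum /=.
move=> /negP; apply; rewrite addrC -lerBrDr; apply: le_trans HM; rewrite EJ.
rewrite (@big_cat_nat _ _ _ J 0) ?leq_addl //= gerDl.
by apply: sumr_le0 => i _; exact: ltW (be_lt0 _).
Qed.

Let above_again n : exists m, (n <= m)%N && (s < S m).
Proof.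
apply: contrapT => /forallNP H.
have Hle m : (n <= m)%N -> S m <= s.
  by move=> nm; rewrite leNgt; apply/negP => Hm; case: (H m); rewrite nm.
have stE t : greedy_state (n + t) = (((greedy_state n).1 + t)%N, (greedy_state n).2).
  elim: t => [|t IH]; first by rewrite !addn0; case: (greedy_state n).
  by rewrite addnS greedyS Hle ?leq_addr // IH /= addnS.
have [M HM] := y_pos (s + 1 - \sum_(0 <= i < (greedy_state n).2) y (be i)).
have [J [_ EJ]] := next_in_enum pos_inf y M.
have := Hle (n + J)%N (leq_addr _ _); rewrite /S stE /psum /=.
apply/negP; rewrite -ltNge -ltrBlDr.
apply: lt_le_trans (_ : \sum_(0 <= b < J) y (enum_in pos_inf b) <= _); last first.
  rewrite (@big_cat_nat _ _ _ J 0 (_ + J)) ?leq_addl //= lerDl.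
  by apply: sumr_ge0.
rewrite -EJ; apply: lt_le_trans HM; lra.
Qed.

Let st1_unb K : exists n, (K <= (greedy_state n).1)%N.
Proof.
elim: K => [|K [n Kn]]; first by exists 0%N.
have [m /andP[nm Sm]] := below_again n; exists m.+1.
by rewrite greedyS Sm /= ltnS; apply: leq_trans Kn (st1_le nm).
Qed.

Let st2_unb K : exists n, (K <= (greedy_state n).2)%N.
Proof.
elim: K => [|K [n Kn]]; first by exists 0%N.
have [m /andP[nm Sm]] := above_again n; exists m.+1.
by rewrite greedyS leNgt Sm /= ltnS; apply: leq_trans Kn (st2_le nm).
Qed.

Let greedy_perm_inj : injective greedy_perm.
Proof.
suff H m n : (m < n)%N -> greedy_perm m != greedy_perm n.
  move=> m n e; case: (ltngtP m n) => // /H; by rewrite e eqxx.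
move=> mn; apply/eqP; rewrite /greedy_perm -/(S m) -/(S n).
case: ifP => hm; case: ifP => hn.
- move=> /enum_in_inj e; have := st1_le mn.
  by rewrite greedyS hm /= e ltnn.
- by move=> e; have := al_ge0 (greedy_state m).1; rewrite e leNgt be_lt0.
- by move=> e; have := al_ge0 (greedy_state n).1; rewrite -e leNgt be_lt0.
- move=> /enum_in_inj e; have := st2_le mn.
  by rewrite greedyS hm /= e ltnn.
Qed.

Let greedy_perm_surj k : exists n, greedy_perm n = k.
Proof.
have [Pk|Nk] := boolP (0 <= y k).
  have [i <-] := enum_in_surj pos_inf Pk.
  case: (ex_minnP (st1_unb i.+1)) => -[//|n]; rewrite greedyS => Hn nmin.
  have ni : ((greedy_state n).1 <= i)%N.
    by rewrite leqNgt; apply/negP => /nmin; rewrite ltnn.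
  exists n; rewrite /greedy_perm -/(S n); move: Hn; case: ifP => _ /= Hn.
    by congr al; apply/eqP; rewrite eqn_leq ni.
  by move: (leq_trans Hn ni); rewrite ltnn.
have [i <-] := enum_in_surj neg_inf Nk.
case: (ex_minnP (st2_unb i.+1)) => -[//|n]; rewrite greedyS => Hn nmin.
have ni : ((greedy_state n).2 <= i)%N.
  by rewrite leqNgt; apply/negP => /nmin; rewrite ltnn.
exists n; rewrite /greedy_perm -/(S n); move: Hn; case: ifP => _ /= Hn.
  by move: (leq_trans Hn ni); rewrite ltnn.
by congr be; apply/eqP; rewrite eqn_leq ni.
Qed.

Lemma greedy_perm_bij : bijective greedy_perm.
Proof. exact: bijective_inj_surj. Qed.

Lemma greedy_perm_cvg :
  (\sum_(0 <= k < n) y (greedy_perm k)) @[n --> \oo] --> s.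
Proof.
apply/cvg_epsP => e e0.
have [K HK] := y_null e0.
have [N HN] := bijective_ge K greedy_perm_bij.
have small n : (N <= n)%N -> `|y (greedy_perm n)| < e by move=> /HN /HK.
(* A step of size below [e] directed towards [s] cannot leave its [e]-neighbourhood. *)
have stay n : (N <= n)%N -> `|S n - s| < e -> `|S n.+1 - s| < e.
  move=> /small; rewrite SS /greedy_perm -/(S n) !ltr_norml.
  have [Sn|Sn] := leP (S n) s.
    have := al_ge0 (greedy_state n).1; lra.
  have := be_lt0 (greedy_state n).2; lra.
(* The first crossing of [s] after time [N] overshoots by less than [e]. *)
have [n1 [Nn1 Hn1]] : exists n, (N <= n)%N /\ `|S n - s| < e.
  have [SN|SN] := leP (S N) s.
    case: (ex_minnP (above_again N)) => m /andP[Nm Sm] mmin.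
    have {}Nm : (N < m)%N.
      by move: Nm; rewrite leq_eqVlt => /orP[/eqP eN|//]; move: Sm; rewrite -eN ltNge SN.
    case: m Nm Sm mmin => // m Nm Sm mmin; exists m.+1; split; first exact: ltnW.
    have Sm' : S m <= s.
      rewrite leNgt; apply/negP => h; have := mmin m; rewrite -ltnS Nm h.
      by move=> /(_ isT); rewrite ltnn.
    have := small m Nm; move: Sm; rewrite SS !ltr_norml; lra.
  case: (ex_minnP (below_again N)) => m /andP[Nm Sm] mmin.
  have {}Nm : (N < m)%N.
    by move: Nm; rewrite leq_eqVlt => /orP[/eqP eN|//]; move: Sm; rewrite -eN leNgt SN.
  case: m Nm Sm mmin => // m Nm Sm mmin; exists m.+1; split; first exact: ltnW.
  have Sm' : s < S m.
    rewrite ltNge; apply/negP => h; have := mmin m; rewrite -ltnS Nm h.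
    by move=> /(_ isT); rewrite ltnn.
  have := small m Nm; move: Sm; rewrite SS !ltr_norml; lra.
exists n1 => n /subnK <-; rewrite greedy_sum; elim: (n - n1)%N => // k IH.
by rewrite addSn; apply: stay => //; apply: leq_trans Nn1 (leq_addl _ _).
Qed.

End Riemann.

(* The greedy algorithm needs both signed parts to diverge: they do, since
   their sum stays bounded along the same indices where their difference blows up. *)
Lemma riemann_rearrangement {R : realType} (y : nat -> R) (K s : R) :
  (forall e : R, 0 < e -> exists N, forall n, (N <= n)%N -> `|y n| < e) ->
  (forall L : R, exists M, `|\sum_(0 <= n < M) y n| <= K /\
                       L <= \sum_(0 <= n < M) `|y n|) ->
  exists2 p : nat -> nat, bijective p &
    (\sum_(0 <= k < n) y (p k)) @[n --> \oo] --> s.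
Proof.
move=> ynull yunb.
have split_sum M : \sum_(0 <= n < M) y n =
    \sum_(0 <= n < M | 0 <= y n) y n + \sum_(0 <= n < M | ~~ (0 <= y n)) y n.
  by rewrite (bigID (fun n => 0 <= y n)).
have split_abs M : \sum_(0 <= n < M) `|y n| =
    \sum_(0 <= n < M | 0 <= y n) y n - \sum_(0 <= n < M | ~~ (0 <= y n)) y n.
  rewrite (bigID (fun n => 0 <= y n)) /= -sumrN; congr +%R.
    by apply: eq_bigr => i /ger0_norm.
  by apply: eq_bigr => i; rewrite -ltNge => /ltr0_norm.
have ypos L : exists M, L <= \sum_(0 <= n < M | 0 <= y n) y n.
  have [M [h1 h2]] := yunb (2 * L + K); exists M; move: h1 h2.
  rewrite split_sum split_abs ler_norml; lra.
have yneg L : exists M, \sum_(0 <= n < M | ~~ (0 <= y n)) y n <= L.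
  have [M [h1 h2]] := yunb (- 2 * L + K); exists M; move: h1 h2.
  rewrite split_sum split_abs ler_norml; lra.
exists (greedy_perm ypos yneg s); first exact: greedy_perm_bij.
exact: greedy_perm_cvg.
Qed.

(** * Finite involutions with small displacement *)

Section Moves.
Context {R : realType}.
Variable u : nat -> R.

(** The second clause confines the support to [[N, M)], so that moves on successive ranges can be
    glued. *)
Definition is_move (d : R) (N M : nat) (f : nat -> nat) : Prop :=
  [/\ involutive f, (forall n, (n < N) || (M <= n) -> f n = n)%N &
      forall n, `|u n - u (f n)| < d].

Definition move_total (M : nat) (f : nat -> nat) : R :=
  \sum_(0 <= n < M) `|u n - u (f n)|.

Lemma involutive_lt (f : nat -> nat) M :
  involutive f -> (forall n, (M <= n)%N -> f n = n) ->
  forall n, (n < M)%N -> (f n < M)%N.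
Proof.
move=> fK fid n nM; rewrite ltnNge; apply/negP => Mf.
by have := fid _ Mf; rewrite fK => e; move: Mf; rewrite -e leqNgt nM.
Qed.

Definition move_cat (M : nat) (f g : nat -> nat) (n : nat) : nat :=
  if (n < M)%N then f n else g n.

Lemma move_cat_invol M K f g :
  involutive f -> (forall n, (M <= n)%N -> f n = n) ->
  involutive g -> (forall n, (n < M) || (K <= n) -> g n = n)%N ->
  involutive (move_cat M f g).
Proof.
move=> fK fid gK gid n; rewrite /move_cat.
have [nM|Mn] := ltnP n M; first by rewrite involutive_lt // fK.
have [gM|_] := ltnP (g n) M; last exact: gK.
have := gid (g n); rewrite gM gK /= => /(_ isT) e.
by move: gM; rewrite -e ltnNge Mn.
Qed.

Lemma move_total_cat M K f g d : (M <= K)%N -> is_move d M K g ->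
  move_total K (move_cat M f g) = move_total M f + move_total K g.
Proof.
move=> MK [_ gid _]; rewrite /move_total (@big_cat_nat _ _ _ M 0 K) //=.
rewrite [X in _ = _ + X](@big_cat_nat _ _ _ M 0 K) //=.
rewrite [X in _ = _ + (X + _)]big_nat [X in _ = _ + (X + _)]big1 ?add0r; last first.
  by move=> i /andP[_ iM]; rewrite gid ?iM // subrr normr0.
congr +%R; apply: eq_big_nat => i /andP[h1 h2]; rewrite /move_cat.
  by rewrite h2.
by rewrite ltnNge h1.
Qed.

Lemma move_widen d N M K f : (M <= K)%N -> is_move d N M f ->
  is_move d N K f /\ move_total M f <= move_total K f.
Proof.
move=> MK [fK fid fd]; split.
  split=> // n /orP[nN|Kn]; apply: fid; first by rewrite nN.
  by rewrite (leq_trans MK Kn) orbT.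
by rewrite /move_total [leRHS](@big_cat_nat _ _ _ M 0 K) //= lerDl sumr_ge0.
Qed.

Lemma moves_unbounded (d eta : R) :
  (forall N, exists M f, is_move d N M f /\ eta <= move_total M f) ->
  forall k N, exists M f,
    [/\ (N <= M)%N, is_move d N M f & eta *+ k <= move_total M f].
Proof.
move=> H; elim=> [|k IH] N.
  (* Any move yields [0 < d], which is what the identity needs to be a move. *)
  have [M0 [f0 [[_ _ hf] _]]] := H 0%N.
  exists N, id; split=> //; last by rewrite mulr0n sumr_ge0.
  split=> // n; rewrite subrr normr0; exact: le_lt_trans (hf n).
have [M [f [NM mf tf]]] := IH N; have [K' [g [mg tg]]] := H M.
pose K := maxn M K'.
have [{}mg tg'] := move_widen (leq_maxr M K') mg.
have MK : (M <= K)%N by exact: leq_maxl.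
exists K, (move_cat M f g); split; first exact: leq_trans MK.
  have [fK fid fd] := mf; have [gK gid gd] := mg; split.
  - apply: (move_cat_invol (K := K)) => // n Mn; apply: fid.
    by rewrite Mn orbT.
  - move=> n; rewrite /move_cat; case: (ltnP n M) => nM /orP[nN|Kn].
    + by apply: fid; rewrite nN.
    + by move: (leq_trans MK Kn); rewrite leqNgt nM.
    + by move: (leq_trans nN NM); rewrite ltnNge nM.
    + by apply: gid; rewrite Kn orbT.
  - by move=> n; rewrite /move_cat; case: ifP.
rewrite (move_total_cat _ MK mg) // mulrSr.
by apply: lerD => //; exact: le_trans tg'.
Qed.

(** Block [j] carries a move of displacement below [1 / (j + 1)] and total at least 1, so
    displacements tend to 0 while the totals diverge. *)
Lemma infinite_move :
  (forall d : R, 0 < d -> forall N, exists M f,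
     [/\ (N <= M)%N, is_move d N M f & 1 <= move_total M f]) ->
  exists t : nat -> nat,
    [/\ involutive t,
        forall e : R, 0 < e -> exists N, forall n, (N <= n)%N -> `|u n - u (t n)| < e &
        forall L : R, exists M, (forall n, (n < M)%N -> (t n < M)%N) /\
                                L <= move_total M t].
Proof.
move=> H.
have inv_gt0 (j : nat) : 0 < (j.+1%:R : R)^-1 by rewrite invr_gt0.
have /choice[F HF] : forall jN : nat * nat, exists Mf : nat * (nat -> nat),
    [/\ (jN.2 <= Mf.1)%N, is_move jN.1.+1%:R^-1 jN.2 Mf.1 Mf.2 &
        1 <= move_total Mf.1 Mf.2].
  move=> [j N]; have [M [f HMf]] := H _ (inv_gt0 j) N.
  by exists (M, f).
(* [N j] is the start of block [j], and [h j] glues the moves of the first [j] blocks. *)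
pose N := fix N (j : nat) : nat :=
  if j is j'.+1 then (F (j', N j')).1 else 0%N.
pose h := fix h (j : nat) : nat -> nat :=
  if j is j'.+1 then move_cat (N j') (h j') (F (j', N j')).2 else id.
(* No block is empty, because a move on an empty block has total 0. *)
have NS j : (N j < N j.+1)%N.
  have [/= le_N [_ gid _] tot] := HF (j, N j).
  rewrite /= ltn_neqAle le_N andbT; apply/eqP => eN.
  move: tot; rewrite leNgt => /negP; apply; rewrite /move_total big1 //.
  move=> i _; rewrite gid ?subrr ?normr0 //.
  by rewrite -eN; case: ltnP.
have N_le i j : (i <= j)%N -> (N i <= N j)%N.
  move=> /subnK <-; elim: (j - i)%N => // k IHk.
  by apply: leq_trans IHk _; rewrite addSn ltnW.
have N_ge j : (j <= N j)%N by elim: j => // j IH; apply: leq_ltn_trans IH _.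
have h_inv j : involutive (h j) /\ (forall n, (N j <= n)%N -> h j n = n).
  elim: j => [|j [hK hid]]; first by split.
  have [/= le_N [gK gid _] _] := HF (j, N j); split=> [|n Nn] /=.
    exact: (move_cat_invol (K := N j.+1)).
  rewrite /move_cat ltnNge (leq_trans (ltnW (NS j)) Nn) /=.
  by apply: gid; rewrite Nn orbT.
have h_stable i j n : (i <= j)%N -> (n < N i)%N -> h j n = h i n.
  move=> /subnK <-; elim: (j - i)%N => // k IHk nN.
  rewrite addSn /= /move_cat (leq_trans nN) ?IHk //.
  by apply: N_le; rewrite leq_addl.
(* The maps [h j] agree at [n] once [n < N j], and [j = n.+1] is large enough since [j <= N j]. *)
pose t n := h n.+1 n.
have tE j n : (n < N j)%N -> t n = h j n.
  move=> nN; rewrite /t; have [nj|jn] := leqP n.+1 j.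
    by rewrite (h_stable n.+1 j).
  by rewrite (h_stable j n.+1) // ltnW.
have t_lt j n : (n < N j)%N -> (t n < N j)%N.
  by move=> nN; rewrite (tE j) //; have [hK hid] := h_inv j; apply: involutive_lt.
exists t; split.
- move=> n; rewrite (tE n.+1) ?t_lt // ?(tE n.+1) //.
  by have [hK _] := h_inv n.+1; exact: hK.
- move=> e e0; pose j := Num.trunc (e^-1); exists (N j) => n jn.
  have je : j.+1%:R^-1 < e :> R.
    by rewrite invf_plt ?posrE //; apply: truncnS_gt.
  suff close k : (n < N k)%N -> `|u n - u (h k n)| < e by rewrite (tE n.+1) // close.
  elim: k => // k IHk.
  have [nk _|kn nk] := ltnP n (N k).
    by rewrite (h_stable k k.+1) // IHk.
  rewrite /= /move_cat ltnNge kn /=.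
  have [_ [_ _ gd] _] := HF (k, N k); apply: lt_trans (gd n) _.
  (* An index from [N j] on lies in a block [k] with [j <= k], whose tolerance is at most that of
     block [j]. *)
  apply: le_lt_trans je; rewrite lef_pV2 ?posrE // ler_nat ltnS leqNgt.
  by apply/negP => /N_le /leq_trans /(_ jn); rewrite leqNgt nk.
- move=> L; exists (N (Num.trunc L).+1); split; first exact: t_lt.
  set j := _.+1; have : j%:R <= move_total (N j) (h j).
    elim: j => [|j IHj]; first by rewrite sumr_ge0.
    have [le_N mg tg] := HF (j, N j).
    rewrite [h _]/= (move_total_cat _ le_N mg) //.
    by rewrite -natr1 lerD.
  rewrite /move_total; under [X in _ -> _ <= X]eq_big_nat => i /andP[_ ij] do
    rewrite (tE j) //.
  by apply: le_trans; rewrite ltW // truncnS_gt.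
Qed.

End Moves.

(* Re-pairing [u n] with [v (t n)] keeps the pair sums null but makes them
   conditionally convergent only, so Riemann's theorem applies to them. *)
Lemma SR2_setT_of_moves {R : realType} (x : nat -> R) (K : R) (t : nat -> nat) :
  let u n := x n.*2 in
  let y n := x n.*2 + x n.*2.+1 in
  (forall e : R, 0 < e -> exists N, forall n, (N <= n)%N -> `|y n| < e) ->
  (forall M, \sum_(0 <= n < M) `|y n| <= K) ->
  involutive t ->
  (forall e : R, 0 < e -> exists N, forall n, (N <= n)%N -> `|u n - u (t n)| < e) ->
  (forall L : R, exists M, (forall n, (n < M)%N -> (t n < M)%N) /\
                                L <= move_total u M t) ->
  SR2 x = setT.
Proof.
move=> u y ynull yabs tK tnull tunb.
have bt : bijective t by exists t.
have bid : bijective (@id nat) by exists id.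
rewrite -(SR2_comp x (pair_perm_bij bid bt)); apply: SR2_setT => s.
set z := x \o _.
have zE n : z n.*2 + z n.*2.+1 = y (t n) + (u n - u (t n)).
  rewrite /z /= pair_perm_even pair_perm_odd /y /u; lra.
have reindex_t (F : nat -> R) M : (forall n, (n < M)%N -> (t n < M)%N) ->
    \sum_(0 <= n < M) F (t n) = \sum_(0 <= n < M) F n.
  move=> tM; rewrite -[LHS](big_map t xpredT F); apply: perm_big.
  apply: uniq_perm; rewrite ?(map_inj_uniq (bij_inj bt)) ?iota_uniq //.
  move=> n; apply/mapP/idP => [[m] |]; rewrite !mem_index_iota /=.
    by move=> mM ->; exact: tM.
  by move=> nM; exists (t n); rewrite ?tK // mem_index_iota /= tM.
apply: (@riemann_rearrangement R (fun n => z n.*2 + z n.*2.+1) K s).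
- move=> e e0; have e2 : 0 < e / 2 by lra.
  have [N1 H1] := ynull _ e2; have [N2 H2] := tnull _ e2.
  have [N3 H3] := bijective_ge N1 bt.
  exists (maxn N2 N3) => n; rewrite geq_max => /andP[n2 n3]; rewrite zE.
  apply: le_lt_trans (ler_normD _ _) _.
  by have := H1 _ (H3 _ n3); have := H2 _ n2; lra.
(* On a [t]-stable range the differences [u n - u (t n)] sum to 0, so the sum of the new pairs stays
   within [K], while their absolute sum is at least the move total minus [K]. *)
- move=> L; have [M [tM LM]] := tunb (L + K); exists M.
  under eq_bigr do rewrite zE.
  rewrite big_split sumrB (reindex_t y) // (reindex_t u) //= subrr addr0; split.
    by apply: le_trans (yabs M); exact: ler_norm_sum.
  have : move_total u M t <= \sum_(0 <= n < M) (`|z n.*2 + z n.*2.+1| + `|y (t n)|).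
    apply: ler_sum => n _; rewrite zE.
    rewrite -[X in `|X| <= _](_ : y (t n) + (u n - u (t n)) - y (t n) = _); last by lra.
    exact: ler_normB.
  rewrite big_split /= (reindex_t (fun n => `|y n|)) //=.
  by have := yabs M; lra.
Qed.

(** * Medians and separated centres *)

Lemma seq_argmin {R : realType} (u : nat -> R) (B : seq nat) n0 :
  n0 \in B -> exists2 i, i \in B & forall k, k \in B -> u i <= u k.
Proof.
elim: B n0 => // b B IH n0 _; case: B IH => [_|b' B IH].
  by exists b; rewrite ?mem_head // => k; rewrite inE => /eqP->.
have [i iB imin] := IH b' (mem_head _ _).
have [le|/ltW le] := leP (u b) (u i).
  exists b; rewrite ?mem_head // => k; rewrite inE => /predU1P[->//|/imin].
  exact: le_trans.
exists i; first by rewrite in_cons iB orbT.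
by move=> k; rewrite in_cons => /predU1P[->//|/imin].
Qed.

(* Matching the smallest element of a class with the largest one, and clamping
   the centre of the rest of the class between the two. *)
Lemma class_medians {R : realType} (u : nat -> R) (cl : nat -> nat) (A : seq nat) :
  uniq A -> exists (c : nat -> R) (f : nat -> nat),
    [/\ involutive f, forall n, n \notin A -> f n = n,
        forall n, cl (f n) = cl n &
        \sum_(n <- A) `|u n - c (cl n)| <= \sum_(n <- A) `|u n - u (f n)|].
Proof.
have [m] := ubnP (size A); elim: m A => // m IH A szA uA.
case: A szA uA => [|n0 A0] szA uA.
  by exists (fun=> 0), id; split=> //; rewrite !big_nil.
move: (n0 :: A0) (mem_head n0 A0) szA uA => A n0A szA uA {A0}.
pose B := [seq n <- A | cl n == cl n0].
have n0B : n0 \in B by rewrite mem_filter eqxx.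
have [i iB imin] := seq_argmin u n0B.
have [j jB jmax] := seq_argmin (fun n => - u n) n0B.
have [iA jA] : i \in A /\ j \in A.
  by move: iB jB; rewrite !mem_filter => /andP[_ ->] /andP[_ ->].
have [ci cj] : cl i = cl n0 /\ cl j = cl n0.
  by move: iB jB; rewrite !mem_filter => /andP[/eqP-> _] /andP[/eqP-> _].
have bnd k : k \in A -> cl k = cl n0 -> u i <= u k <= u j.
  move=> kA ck; have kB : k \in B by rewrite mem_filter ck eqxx.
  by rewrite imin //= -lerN2 jmax.
pose clamp c : R := Num.max (u i) (Num.min (u j) c).
have uij : u i <= u j by have /andP[] := bnd j jA cj.
have clampP c : u i <= clamp c <= u j.
  rewrite /clamp; case: (lerP (u j) c) => h.
    by rewrite max_r // uij lexx.
  by case: (lerP (u i) c) => h'; rewrite ?lexx ?h' ?uij ?(ltW h).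
have clamp_le k c : u i <= u k <= u j -> `|u k - clamp c| <= `|u k - c|.
  have n1 := ler_norm (u k - c); have := ler_norm (c - u k); rewrite distrC => n2.
  rewrite ler_norml /clamp; case: (lerP (u j) c) => h.
    by rewrite max_r //; lra.
  by case: (lerP (u i) c) => h'; lra.
have sub A' (c : nat -> R) : {subset A' <= A} ->
    \sum_(n <- A') `|u n - (if cl n == cl n0 then clamp (c (cl n)) else c (cl n))|
    <= \sum_(n <- A') `|u n - c (cl n)|.
  move=> sA; rewrite big_seq [leRHS]big_seq; apply: ler_sum => k /sA kA.
  by case: eqP => // ck; apply/clamp_le/bnd.
pose A1 := rem i A.
have pA : perm_eq A (i :: A1) by exact: perm_to_rem.
have uA1 : uniq A1 by exact: rem_uniq.
have inA1 k : (k \in A1) = (k != i) && (k \in A) by rewrite mem_rem_uniq.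
have szA1 : size A = (size A1).+1 by rewrite (perm_size pA).
(* If [i = j], all entries of the class in [A] have the value [u i], and the clamped centre is that
   value. *)
have [eij|ij] := eqVneq i j.
  have [|c [f [fK fid fcl fsum]]] := IH A1 _ uA1; first by rewrite -szA1.
  exists (fun k => if k == cl n0 then clamp (c k) else c k), f; split=> //.
    by move=> n nA; apply: fid; rewrite inA1 negb_and nA orbT.
  rewrite (perm_big _ pA) [leRHS](perm_big _ pA) /= !big_cons.
  apply: lerD; last by apply: le_trans fsum; apply: sub => k; rewrite inA1 => /andP[].
  rewrite ci eqxx; have := clampP (c (cl n0)); rewrite -eij -eq_le => /eqP <-.
  by rewrite subrr normr0.
have jA1 : j \in A1 by rewrite inA1 eq_sym ij.
pose A2 := rem j A1.
have pA1 : perm_eq A1 (j :: A2) by exact: perm_to_rem.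
have uA2 : uniq A2 by exact: rem_uniq.
have inA2 k : (k \in A2) = [&& k != j, k != i & k \in A].
  by rewrite mem_rem_uniq // !inE inA1.
have [|c [f [fK fid fcl fsum]]] := IH A2 _ uA2.
  by move: szA; rewrite szA1 (perm_size pA1) /= ltnS => /ltnW.
have fi : f i = i by apply: fid; rewrite inA2 eqxx andbF.
have fj : f j = j by apply: fid; rewrite inA2 eqxx.
exists (fun k => if k == cl n0 then clamp (c k) else c k),
  (fun k => if k == i then j else if k == j then i else f k); split.
- move=> n; have [->|ni] := eqVneq n i; first by rewrite eqxx [j == i]eq_sym (negbTE ij).
  have [->|nj] := eqVneq n j; first by rewrite eqxx.
  by rewrite -{1}fi -{2}fj !(inj_eq (inv_inj fK)) (negbTE ni) (negbTE nj).
- move=> n nA; have [ni|ni] := eqVneq n i; first by rewrite ni iA in nA.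
  have [nj|nj] := eqVneq n j; first by rewrite nj jA in nA.
  by apply: fid; rewrite inA2 (negbTE nA) !andbF.
- move=> n; have [->|ni] := eqVneq n i; first by rewrite ci.
  by have [->|nj] := eqVneq n j; [rewrite ci | exact: fcl].
(* The deviations of [u i] and [u j] from a centre between them add up to [u j - u i], half of what
   the swap contributes. *)
- rewrite (perm_big _ pA) [leRHS](perm_big _ pA) /= !big_cons.
  rewrite (perm_big _ pA1) [X in _ <= _ + X](perm_big _ pA1) /= !big_cons.
  rewrite ci cj !eqxx [j == i]eq_sym (negbTE ij).
  have E : \sum_(k <- A2) `|u k - u (if k == i then j else if k == j then i else f k)|
         = \sum_(k <- A2) `|u k - u (f k)|.
    rewrite big_seq [RHS]big_seq; apply: eq_bigr => k; rewrite inA2.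
    by move=> /and3P[/negbTE-> /negbTE->].
  rewrite E; have := sub A2 c; set S1 := bigop.body _ _ _; set S2 := bigop.body _ _ _.
  move=> sub2; have {sub2} : S1 <= S2.
    by apply: sub2 => k; rewrite inA2 => /and3P[].
  move: fsum; rewrite -/S2; have /andP[h1 h2] := clampP (c (cl n0)).
  rewrite (ler0_norm (x := u i - clamp _)) ?subr_le0 //.
  rewrite (ger0_norm (x := u j - clamp _)) ?subr_ge0 //.
  rewrite (ler0_norm (x := u i - u j)) ?subr_le0 //.
  rewrite (ger0_norm (x := u j - u i)) ?subr_ge0 //.
  lra.
Qed.

Lemma fmap_ultra {T U : Type} (f : T -> U) (G : set_system T) :
  UltraFilter G -> UltraFilter (f @ G).
Proof.
move=> uG; have pG : ProperFilter G by exact: ultra_proper.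
apply: Build_UltraFilter => H pH sub; apply/seteqP; split=> // B HB.
have [//|GC] := in_ultra_setVsetC (f @^-1` B) uG.
have HC : H (~` B) by apply: sub.
have : H (B `&` ~` B) by exact: filterI.
by rewrite setICr => /filter_not_empty.
Qed.

(** Once the range contains a term of a class, the centre chosen for that range is within [K] of it.
    Hence an ultrafilter limit exists for all classes at once, and the bound passes to the limit. *)
Lemma class_centers {R : realType} (u : nat -> R) (cl : nat -> nat) (N : nat) (K : R) :
  (forall M, exists c : nat -> R, \sum_(N <= n < M) `|u n - c (cl n)| <= K) ->
  exists c : nat -> R, forall M, \sum_(N <= n < M) `|u n - c (cl n)| <= K.
Proof.
move=> /choice[cM HcM].
have HcM' M M' : (M <= M')%N -> \sum_(N <= n < M) `|u n - cM M' (cl n)| <= K.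
  move=> le_M; have [NM|MN] := leqP N M; last first.
    rewrite big_geq ?(ltnW MN) //; apply: le_trans (HcM N).
    by rewrite sumr_ge0.
  apply: le_trans (HcM M'); rewrite [leRHS](@big_cat_nat _ _ _ M) //=.
  by rewrite lerDl sumr_ge0.
have [G [uG sG]] := @ultraFilterLemma nat \oo _.
have pG : ProperFilter G by exact: ultra_proper.
have /choice[c Hc] : forall k, exists c : R, forall n, (N <= n)%N -> cl n = k ->
    cM M k @[M --> G] --> c.
  move=> k; have [[n [Nn cn]]|noclass] := pselect (exists n, (N <= n)%N /\ cl n = k).
    have := @segment_compact R (u n - K) (u n + K).
    rewrite compact_ultra => /(_ _ (fmap_ultra (fun M => cM M k) uG)).
    case=> [|c [_ cc]]; last by exists c.
    apply: sG; exists n.+1 => // M /= nM; rewrite in_itv /=.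
    have /= := HcM' n.+1 M nM; rewrite big_nat_recr //= cn => h.
    have : `|u n - cM M k| <= K by apply: le_trans h; rewrite lerDr sumr_ge0.
    rewrite ler_norml; lra.
  by exists 0 => n Nn cn; case: noclass; exists n.
exists c => M.
have : \sum_(N <= n < M) `|u n - cM M' (cl n)| @[M' --> G] -->
       \sum_(N <= n < M) `|u n - c (cl n)|.
  rewrite big_nat; under eq_fun do rewrite big_nat.
  apply: cvg_big; first exact: add_continuous.
  move=> n /andP[Nn _]; apply: cvg_norm; apply: cvgB; first exact: cvg_cst.
  exact: (Hc (cl n) n).
apply: (@closed_cvg _ _ G _ _ (fun z => z <= K)); first exact: closed_le.
by apply: sG; exists M => // M' /= /HcM'.
Qed.

(** Taking [eta = d / 8] leaves a gap: no distance between far terms lies in [[d / 8, d)]. Being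
    closer than [d] is then an equivalence relation, and medians of its classes serve as centres. *)
Lemma separated_centers {R : realType} (u : nat -> R) (d : R) : 0 < d ->
  (forall eta : R, 0 < eta -> exists N, forall M f, is_move u d N M f ->
     move_total u M f < eta) ->
  exists (C : nat -> R) (N : nat) (e K : R),
    [/\ 0 < e,
        forall n m, (N <= n)%N -> (N <= m)%N -> C n != C m -> e < `|C n - C m| &
        forall M, \sum_(N <= n < M) `|u n - C n| <= K].
Proof.
move=> d0 small; have eta0 : 0 < d / 8 by lra.
have [N HN] := small _ eta0.
have close n m : (N <= n)%N -> (N <= m)%N -> `|u n - u m| < d -> `|u n - u m| < d / 8.
  move=> Nn Nm nmd; have [->|nm] := eqVneq n m; first by rewrite subrr normr0.
  (* The transposition of [n] and [m] is a move whose total bounds their distance. *)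
  pose f k := if k == n then m else if k == m then n else k.
  have mf : is_move u d N (maxn n m).+1 f.
    split.
    - move=> k; rewrite /f; have [->|kn] := eqVneq k n.
        by rewrite eq_sym (negbTE nm) eqxx.
      by have [->|km] := eqVneq k m; rewrite ?eqxx // (negbTE kn) (negbTE km).
    - move=> k hk; rewrite /f.
      have kn : (k == n) = false by apply/negbTE/eqP; move: hk; lia.
      have km : (k == m) = false by apply/negbTE/eqP; move: hk; lia.
      by rewrite kn km.
    - move=> k; rewrite /f; have [->//|_] := eqVneq k n.
      have [->|_] := eqVneq k m; first by rewrite distrC.
      by rewrite subrr normr0.
  apply: le_lt_trans (HN _ _ mf); rewrite /move_total (bigD1_seq n).
  - have -> : f n = m by rewrite /f eqxx.
    by rewrite lerDl sumr_ge0.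
  - by rewrite mem_index_iota ltnS leq_maxl.
  - by rewrite iota_uniq.
(* The label of [n] is the least index from [N] on in its class; the disjunct [n < N] makes the
   label defined for every [n]. *)
have exP n : exists k, (N <= k)%N && ((n < N)%N || (`|u k - u n| < d)).
  exists (maxn N n); rewrite leq_maxl /=; have [//|Nn] := ltnP n N.
  by rewrite subrr normr0.
pose cl n := ex_minn (exP n).
have clP n : (N <= n)%N -> (N <= cl n)%N /\ `|u (cl n) - u n| < d / 8.
  move=> Nn; rewrite /cl; case: ex_minnP => k /andP[Nk].
  by rewrite ltnNge Nn /= => /close h _; split=> //; apply: h.
have cl_min n k : (N <= n)%N -> (N <= k)%N -> `|u k - u n| < d -> (cl n <= k)%N.
  move=> Nn Nk h; rewrite /cl; case: ex_minnP => k' _; apply.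
  by rewrite Nk h orbT.
have cl_le n m : (N <= n)%N -> (N <= m)%N -> `|u n - u m| < d -> (cl n <= cl m)%N.
  move=> Nn Nm /close; move=> /(_ Nn Nm) nm.
  have [Ncm hm] := clP m Nm; apply: cl_min => //.
  have := ler_normD (u (cl m) - u m) (u m - u n).
  rewrite addrA subrK (distrC (u m) (u n)); lra.
have cl_eq n m : (N <= n)%N -> (N <= m)%N -> `|u n - u m| < d -> cl n = cl m.
  move=> Nn Nm nm; apply/eqP; rewrite eqn_leq !cl_le //.
  by rewrite distrC.
have cl_close n m : (N <= n)%N -> (N <= m)%N -> cl n = cl m -> `|u n - u m| < d.
  move=> Nn Nm e; have [_ h1] := clP n Nn; have [_ h2] := clP m Nm.
  have := ler_normD (u n - u (cl n)) (u (cl n) - u m).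
  rewrite addrA subrK (distrC (u n) (u (cl n))); move: h2; rewrite -e; lra.
have [c Hc] : exists c : nat -> R, forall M,
    \sum_(N <= n < M) `|u n - c (cl n)| <= d / 8.
  apply: class_centers => M.
  (* The matching preserves classes, whose members are closer than [d], so it is a move and its
     total is below [d / 8]. *)
  have [c [f [fK fid fcl fsum]]] := class_medians u cl (iota_uniq N (M - N)).
  exists c; apply: le_trans fsum _.
  have fA n : (n \in index_iota N M) -> f n \in index_iota N M.
    move=> nA; apply: contraT => fn; have := fid _ fn; rewrite fK => e.
    by rewrite -e nA in fn.
  have mf : is_move u d N M f.
    split=> // [n hn|n].
      by apply: fid; rewrite mem_index_iota; move: hn; lia.
    have [nA|nA] := boolP (n \in index_iota N M); last first.
      by rewrite fid // subrr normr0.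
    have := fA _ nA; move: nA; rewrite !mem_index_iota => /andP[h1 _] /andP[h2 _].
    exact: cl_close.
  have [NM|MN] := leqP N M; last first.
    by rewrite (eqP (ltnW MN : (M - N == 0)%N)) big_nil ltW.
  apply: le_trans (ltW (HN _ _ mf)); rewrite /move_total.
  by rewrite [leRHS](@big_cat_nat _ _ _ N 0 M) //= lerDr sumr_ge0.
have Hc1 n : (N <= n)%N -> `|u n - c (cl n)| <= d / 8.
  move=> Nn; apply: le_trans (Hc n.+1); rewrite big_nat_recr //=.
  by rewrite lerDr sumr_ge0.
(* Terms of different classes are at least [d] apart and each is within [d / 8] of its centre, which
   leaves at least [3 * d / 4] between distinct centres. *)
exists (c \o cl), N, (d / 2), (d / 8); split=> //; first by lra.
move=> n m Nn Nm /= ne; have := Hc1 n Nn; have := Hc1 m Nm.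
have : d <= `|u n - u m|.
  by rewrite leNgt; apply/negP => /(cl_eq _ _ Nn Nm) e; rewrite e eqxx in ne.
have := ler_normD (u n - c (cl n)) (c (cl n) - u m).
have := ler_normD (c (cl n) - c (cl m)) (c (cl m) - u m).
rewrite !addrA !subrK (distrC (c (cl m)) (u m)); lra.
Qed.

(** * Inserting a limit of terms *)

Lemma sum_nat_recr2 {V : nmodType} (F : nat -> V) m :
  \sum_(0 <= k < m.+2) F k = \sum_(0 <= k < m) F k + F m + F m.+1.
Proof. by rewrite !big_nat_recr. Qed.

Section Insertion.
Context {R : realType}.

(** The offset [d] is the length of an initial block after which the pairs begin; inserting one term
    lengthens it by one. *)
Definition recurrent_pairs (z : nat -> R) (d : nat) (E : set R) : Prop :=
  forall g, E g -> exists I : pred nat,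
    (forall M, exists n, (M <= n)%N && I n) /\
    forall e : R, 0 < e -> exists M, forall n, (M <= n)%N -> I n ->
      `|z (d + n.*2)%N - g| < e /\ `|z (d + n.*2.+1)%N + g| < e.

Section InsertPerm.
Variables (d : nat) (I : pred nat) (infI : forall M, exists n, (M <= n)%N && I n).

Let next := next_in infI.
Let shift n := if I n then next n.+1 else n.

(** A shift in the style of Hilbert's hotel: the first term of the first pair in [I] moves to the
    front, and each later such term takes the place of the preceding one. *)
Definition insert_perm (k : nat) : nat :=
  if k is k'.+1 then
    if (k' < d)%N then k'
    else if odd (k' - d) then k' else (d + (shift (k' - d)./2).*2)%N
  else (d + (next 0).*2)%N.

Let q_0 : insert_perm 0 = (d + (next 0).*2)%N.
Proof. by []. Qed.

Let q_lt k : (k < d)%N -> insert_perm k.+1 = k.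
Proof. by rewrite /= => ->. Qed.

Lemma insert_perm_even n : insert_perm (d.+1 + n.*2) =
  (d + (if I n then next_in infI n.+1 else n).*2)%N.
Proof.
by rewrite addSn /= ltnNge leq_addr /= addKn odd_double doubleK.
Qed.

Lemma insert_perm_odd n : insert_perm (d.+1 + n.*2.+1) = (d + n.*2.+1)%N.
Proof.
by rewrite addSn /= ltnNge leq_addr /= addKn /= odd_double.
Qed.

Let qP k : [\/ k = 0%N, exists2 k', (k' < d)%N & k = k'.+1,
  exists n, k = (d.+1 + n.*2)%N | exists n, k = (d.+1 + n.*2.+1)%N].
Proof.
case: k => [|k]; first by constructor 1.
have [kd|dk] := ltnP k d; first by constructor 2; exists k.
have := odd_double_half (k - d); case: (odd _) => e.
  by constructor 4; exists (k - d)./2; lia.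
by constructor 3; exists (k - d)./2; lia.
Qed.

Let shift_inj : injective shift.
Proof.
suff H m n : (m < n)%N -> shift m != shift n.
  by move=> m n e; case: (ltngtP m n) => // /H; rewrite e eqxx.
move=> mn; rewrite /shift; case: ifP => Im; case: ifP => In.
- rewrite neq_ltn; apply/orP; left.
  by apply: leq_ltn_trans (next_in_ge infI n.+1); apply: next_in_min.
- by apply/eqP => e; have := next_inP infI m.+1; rewrite -/next e In.
- by apply/eqP => e; have := next_inP infI n.+1; rewrite -/next -e Im.
- by rewrite neq_ltn mn.
Qed.

Let shift_neq n : shift n != next 0.
Proof.
rewrite /shift; case: ifP => In; rewrite neq_ltn.
  apply/orP; right; apply: leq_ltn_trans (next_in_ge infI n.+1).
  exact: next_in_min.
by rewrite -neq_ltn; apply/eqP => e; have := next_inP infI 0; rewrite -/next -e In.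
Qed.

Let shift_surj n : n = next 0 \/ exists m, shift m = n.
Proof.
have [In|In] := boolP (I n); last by right; exists n; rewrite /shift (negbTE In).
have exk : exists k, next k == n by exists n; rewrite /next next_in_id.
(* If the least index with [next] equal to [n] is [k.+1], then [k] lies in [I], as otherwise
   [next k] would be [n] too; hence [shift k = n]. *)
case: (ex_minnP exk) => -[/eqP <- _|k /eqP ek kmin]; first by left.
right; exists k; rewrite /shift; case: ifP => // /negbT Ik.
have := kmin k; rewrite /next next_in_notin // -/next ek eqxx ltnn.
by move=> /(_ isT).
Qed.

Lemma insert_perm_bij : bijective insert_perm.
Proof.
apply: bijective_inj_surj => [k1 k2|n].
  case: (qP k1) => [->|[k1' h1 ->]|[n1 ->]|[n1 ->]];
  case: (qP k2) => [->|[k2' h2 ->]|[n2 ->]|[n2 ->]];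
  rewrite ?insert_perm_even ?insert_perm_odd; rewrite ?q_lt //; rewrite ?q_0; try lia.
  - by move=> /addnI/double_inj e; case/eqP: (shift_neq n2).
  - by move=> /addnI/double_inj e; case/eqP: (shift_neq n1).
  - by move=> /addnI/double_inj/shift_inj ->.
have [nd|dn] := ltnP n d; first by exists n.+1; rewrite q_lt.
have := odd_double_half (n - d); case: (odd _) => e.
  by exists (d.+1 + (n - d)./2.*2.+1)%N; rewrite insert_perm_odd; lia.
have [e0|[m em]] := shift_surj (n - d)./2.
  by exists 0%N; rewrite /= -e0; lia.
by exists (d.+1 + m.*2)%N; rewrite insert_perm_even -/(shift m) em; lia.
Qed.

(* The shifted terms telescope, leaving one term of the subsequence. *)
Lemma insert_perm_sum (z : nat -> R) n :
  \sum_(0 <= k < d.+1 + n.*2) z (insert_perm k) =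
  \sum_(0 <= k < d + n.*2) z k + z (d + (next n).*2)%N.
Proof.
elim: n => [|n IH].
  rewrite !addn0 big_nat_recl //= addrC; congr +%R.
  by apply: eq_big_nat => k /andP[_ kd]; rewrite kd.
rewrite doubleS !addnS 2!sum_nat_recr2 IH -!addnS insert_perm_even insert_perm_odd /next.
case: ifP => In; first by rewrite (next_in_id _ In); lra.
by rewrite (next_in_notin _ (negbT In)); lra.
Qed.

End InsertPerm.

(** The new sums exceed the old ones by a single term with index in [I], which tends to [g]. *)
Lemma insert_term (z : nat -> R) (d : nat) (E : set R) (s g : R) :
  (\sum_(0 <= k < d + n.*2) z k) @[n --> \oo] --> s ->
  recurrent_pairs z d E -> E g ->
  exists q, [/\ bijective q,
    (\sum_(0 <= k < d.+1 + n.*2) z (q k)) @[n --> \oo] --> s + g &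
    recurrent_pairs (z \o q) d.+1 E].
Proof.
move=> zs rec Eg; have [I [infI HI]] := rec g Eg.
exists (insert_perm d infI); split; first exact: insert_perm_bij.
  under eq_fun do rewrite insert_perm_sum.
  apply: cvgD => //; apply/cvg_epsP => e e0; have [M HM] := HI e e0.
  exists M => n Mn; apply: (HM _ _ (next_inP infI n)).1.
  exact: leq_trans (next_in_ge _ _).
move=> h Eh; have [J [infJ HJ]] := rec h Eh.
exists J; split=> // e e0; have e3 : 0 < e / 3 by lra.
have [M1 H1] := HI _ e3; have [M2 H2] := HJ _ e3.
exists (maxn M1 M2) => n; rewrite geq_max => /andP[n1 n2] Jn.
have [h1 h2] := H2 n n2 Jn; split; rewrite [(_ \o _) _]/comp; last first.
  rewrite insert_perm_odd; lra.
rewrite insert_perm_even.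
(* At an index in both [I] and [J] the old term is close to [h] and to [g], and the new one is close
   to [g]; the three errors of [e / 3] add up. *)
case: ifP => In; last by lra.
have [a1 _] := H1 n n1 In.
have [b1 _] := H1 _ (leq_trans (leqW n1) (next_in_ge infI n.+1)) (next_inP infI n.+1).
move: h1 a1 b1; rewrite !ltr_norml; lra.
Qed.

(** Exchanging the terms of every pair past the offset [d] replaces a recurrent [g] by [- g] and
    keeps the sums that end after a full pair. *)
Definition flip (d k : nat) : nat :=
  if (k < d)%N then k else if odd (k - d) then k.-1 else k.+1.

Lemma flip_even d n : flip d (d + n.*2) = (d + n.*2.+1)%N.
Proof. by rewrite /flip ltnNge leq_addr /= addKn odd_double addnS. Qed.

Lemma flip_odd d n : flip d (d + n.*2.+1) = (d + n.*2)%N.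
Proof. by rewrite /flip ltnNge leq_addr /= addKn /= odd_double addnS. Qed.

Lemma flip_bij d : bijective (flip d).
Proof.
suff fK : involutive (flip d) by exists (flip d).
move=> k; have [kd|dk] := ltnP k d; first by rewrite /flip kd kd.
have := odd_double_half (k - d); case: (odd _) => e.
  have -> : k = (d + (k - d)./2.*2.+1)%N by lia.
  by rewrite flip_odd flip_even.
have -> : k = (d + (k - d)./2.*2)%N by lia.
by rewrite flip_even flip_odd.
Qed.

Lemma flip_sum (z : nat -> R) d n :
  \sum_(0 <= k < d + n.*2) z (flip d k) = \sum_(0 <= k < d + n.*2) z k.
Proof.
elim: n => [|n IH].
  by rewrite addn0; apply: eq_big_nat => k /andP[_ kd]; rewrite /flip kd.
by rewrite doubleS !addnS 2!sum_nat_recr2 IH -!addnS flip_even flip_odd addrAC.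
Qed.

Lemma flip_recurrent (z : nat -> R) d (E E' : set R) :
  (forall g, E' g -> E (- g)) ->
  recurrent_pairs z d E -> recurrent_pairs (z \o flip d) d E'.
Proof.
move=> EE' rec g /EE' Eg; have [I [infI HI]] := rec _ Eg.
exists I; split=> // e e0; have [M HM] := HI e e0.
exists M => n Mn In; rewrite /= flip_even flip_odd.
by have [h1 h2] := HM n Mn In; rewrite opprK in h1.
Qed.

Lemma insert_terms (E : set R) (l : seq R) (z : nat -> R) (d : nat) (s : R) :
  (forall g, g \in l -> E g \/ E (- g)) ->
  (\sum_(0 <= k < d + n.*2) z k) @[n --> \oo] --> s ->
  recurrent_pairs z d E ->
  exists q, bijective q /\
    (\sum_(0 <= k < d + size l + n.*2) z (q k)) @[n --> \oo] --> s + \sum_(g <- l) g.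
Proof.
elim: l z d s => [|g l IH] z d s lE zs rec.
  by exists id; split; [exists id|rewrite big_nil addr0 addn0].
have lE' h : h \in l -> E h \/ E (- h).
  by move=> hl; apply: lE; rewrite in_cons hl orbT.
suff [q [bq qs qrec]] : exists q, [/\ bijective q,
    (\sum_(0 <= k < d.+1 + n.*2) z (q k)) @[n --> \oo] --> s + g &
    recurrent_pairs (z \o q) d.+1 E].
  have [q' [bq' qs']] := IH (z \o q) d.+1 (s + g) lE' qs qrec.
  exists (q \o q'); split; first exact: bij_comp.
  by rewrite big_cons addrA /= addnS -addSn.
have [Eg|Eg] := lE g (mem_head _ _); first exact: insert_term.
(* Here it is [- g] that belongs to [E]: flip, insert a first term close to [g], and flip back. *)
pose E' : set R := [set h | E (- h)].
have zs' : (\sum_(0 <= k < d + n.*2) (z \o flip d) k) @[n --> \oo] --> s.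
  by under eq_fun do rewrite flip_sum.
have rec' : recurrent_pairs (z \o flip d) d E' by exact: (flip_recurrent (E := E)).
have [q [bq qs qrec]] := insert_term zs' rec' (g := g) Eg.
exists (flip d \o (q \o flip d.+1)); split.
- by apply: bij_comp; [exact: flip_bij|apply: bij_comp => //; exact: flip_bij].
- by under eq_fun do rewrite (flip_sum (fun k => z (flip d (q k)))).
- apply: (@flip_recurrent (z \o flip d \o q) _ E') => // h Eh.
  by rewrite /E' /= opprK.
Qed.

(** Inserting an even number of terms gives an even offset, so the convergent sums are again those
    of even length. *)
Lemma SR2_add_terms (E : set R) (l : seq R) (x : nat -> R) (a : R) :
  (forall g, g \in l -> E g \/ E (- g)) -> ~~ odd (size l) ->
  sum_2n x n @[n --> \oo] --> a -> recurrent_pairs x 0 E ->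
  SR2 x (a + \sum_(g <- l) g).
Proof.
move=> lE evl xa rec.
have xa' : (\sum_(0 <= k < 0 + n.*2) x k) @[n --> \oo] --> a.
  by under eq_fun do rewrite add0n -mul2n.
have [q [bq qs]] := insert_terms lE xa' rec.
exists q => //; apply/cvg_epsP => e e0; have /cvg_epsP/(_ e e0)[N HN] := qs.
exists (N + (size l)./2)%N => n Nn.
have := HN (n - (size l)./2)%N; rewrite /sum_2n.
have -> : (0 + size l + (n - (size l)./2).*2 = 2 * n)%N.
  have := odd_double_half (size l); rewrite (negbTE evl); lia.
by apply; lia.
Qed.

End Insertion.

(** * Sums over rearrangements *)

Lemma summable_tail {R : realType} (w : nat -> R) (K : R) :
  (forall n, 0 <= w n) -> (forall M, \sum_(0 <= n < M) w n <= K) ->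
  forall e : R, 0 < e -> exists N, forall M, \sum_(N <= n < M) w n < e.
Proof.
move=> w0 wK e e0; apply: contrapT => /forallNP H.
have {}H N : exists M, e <= \sum_(N <= n < M) w n.
  have /existsNP[M HM] := H N; exists M; rewrite leNgt; exact/negP.
have big k : exists M, e *+ k <= \sum_(0 <= n < M) w n.
  elim: k => [|k [M HM]]; first by exists 0%N; rewrite big_geq // mulr0n.
  have [M' HM'] := H M; exists M'.
  have MM' : (M <= M')%N.
    by rewrite leqNgt; apply/negP => /ltnW h; move: HM'; rewrite big_geq // leNgt e0.
  by rewrite (@big_cat_nat _ _ _ M 0 M') //= mulrSr lerD.
have [M] := big (Num.trunc (K / e)).+1; apply/negP; rewrite -ltNge.
apply: le_lt_trans (wK M) _; rewrite -mulr_natr mulrC -ltr_pdivrMr //.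
exact: truncnS_gt.
Qed.

Lemma sum_bij_split {V : nmodType} (phi : nat -> V) (p : nat -> nat) (N : nat) :
  bijective p -> exists n0, forall n, (n0 <= n)%N ->
    \sum_(0 <= k < n) phi (p k) =
    \sum_(0 <= k < N) phi k + \sum_(0 <= k < n | (N <= p k)%N) phi (p k).
Proof.
move=> bp; have [g pK gK] := bp.
exists (\max_(k < N) (g k).+1)%N => n le_n.
rewrite (bigID (fun k => (p k < N)%N)) /=; congr (_ + _)%R; last first.
  by apply: eq_bigl => k; rewrite -leqNgt.
rewrite -big_filter -(big_map p xpredT phi); apply: perm_big.
apply: uniq_perm; rewrite ?iota_uniq //.
  by rewrite map_inj_uniq ?filter_uniq ?iota_uniq //; exact: bij_inj.
move=> k; rewrite mem_index_iota /=; apply/mapP/idP => [[j]|kN].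
  by rewrite mem_filter => /andP[h _] ->.
exists (g k); rewrite ?gK // mem_filter gK kN mem_index_iota /=.
exact: leq_trans (leq_bigmax (F := fun k : 'I_N => (g k).+1) (Ordinal kN)) le_n.
Qed.

(** For [n] large, what remains besides the first [N] terms is a sum over distinct indices from [N]
    on, dominated by the tail. *)
Lemma summable_rearrangement {R : realType} (r : nat -> R) (p : nat -> nat) (e : R) N :
  bijective p -> (forall M, \sum_(N <= n < M) `|r n| < e) ->
  exists n0, forall n, (n0 <= n)%N ->
    `|\sum_(0 <= k < n) r (p k) - \sum_(0 <= k < N) r k| < e.
Proof.
move=> bp tail; have [n0 Hn0] := sum_bij_split r N bp.
exists n0 => n /Hn0 ->; rewrite addrAC subrr add0r.
pose M := (\max_(k < n) (p k).+1)%N.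
apply: le_lt_trans (tail M); apply: le_trans (ler_norm_sum _ _ _) _.
rewrite -big_filter -(big_map p xpredT (fun k => `|r k|)).
set s := map _ _.
have us : uniq s by rewrite map_inj_uniq ?filter_uniq ?iota_uniq //; exact: bij_inj.
have sN k : k \in s -> k \in index_iota N M.
  move=> /mapP[j]; rewrite mem_filter mem_index_iota /= => /andP[h jn] ->.
  rewrite mem_index_iota h /=.
  exact: (leq_bigmax (F := fun k : 'I_n => (p k).+1) (Ordinal jn)).
rewrite (perm_big [seq k <- index_iota N M | k \in s]); last first.
  apply: uniq_perm; rewrite ?filter_uniq ?iota_uniq // => k.
  by rewrite mem_filter; case: (boolP (k \in s)) => // /sN ->.
rewrite big_filter [leRHS](bigID (mem s)) /= lerDl.
by rewrite sumr_ge0.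
Qed.

(** * Cancelling pairs and balance of finite sums *)

Section Balance.
Variables (V : zmodType) (p : nat -> nat) (m0 : nat).
Hypothesis bp : bijective p.

Lemma cancelling_pairs (phi : nat -> V) (q : nat -> nat) :
  (forall i, (m0 <= i)%N -> phi (q i.*2) + phi (q i.*2.+1) = 0) ->
  forall m, (m0 <= m)%N ->
    \sum_(0 <= k < m.*2) phi (q k) = \sum_(0 <= k < m0.*2) phi (q k).
Proof.
move=> H m /subnK <-; elim: (m - m0)%N => // k IH.
rewrite addSn doubleS sum_nat_recr2 -addrA H ?addr0 ?leq_addl //.
Qed.

(** Both orders eventually exhaust the finite support, and cancelling pairs do not change the sum
    after the first [m0] pairs. *)
Lemma balance_finite (phi : nat -> V) (B : nat) :
  (forall i, (m0 <= i)%N -> phi (p i.*2) + phi (p i.*2.+1) = 0) ->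
  (forall i, (m0 <= i)%N -> phi i.*2 + phi i.*2.+1 = 0) ->
  (forall k, (B <= k)%N -> phi k = 0) ->
  \sum_(0 <= k < m0.*2) phi (p k) = \sum_(0 <= k < m0.*2) phi k.
Proof.
move=> Hp Hid HB.
have total q : bijective q -> exists n0, forall n, (n0 <= n)%N ->
    \sum_(0 <= k < n) phi (q k) = \sum_(0 <= k < B) phi k.
  move=> bq; have [n0 H] := sum_bij_split phi B bq; exists n0 => n /H ->.
  by rewrite [X in _ + X]big1 ?addr0 // => k; exact: HB.
have [n1 H1] := total p bp; have [n2 H2] := total id (Bijective (fun=> erefl) (fun=> erefl)).
pose m := (m0 + n1 + n2)%N.
rewrite -(cancelling_pairs Hp (m := m)) /m; last by lia.
rewrite -(@cancelling_pairs phi id Hid m) /m; last by lia.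
by rewrite H1 ?H2 //; lia.
Qed.

(** The fibres of [key] through nonzero terms among the first [m0] pairs, in either order, are
    finite in number and size. Late pairs share their key, so restricting [phi] to these fibres
    preserves cancellation. The group is arbitrary so that both real values and parities can be
    balanced. *)
Lemma balance_finite_fibres {T : eqType} (key : nat -> T) (phi : nat -> V) :
  (forall i, (m0 <= i)%N -> phi (p i.*2) + phi (p i.*2.+1) = 0) ->
  (forall i, (m0 <= i)%N -> phi i.*2 + phi i.*2.+1 = 0) ->
  (forall i, (m0 <= i)%N -> key (p i.*2) = key (p i.*2.+1)) ->
  (forall i, (m0 <= i)%N -> key i.*2 = key i.*2.+1) ->
  (forall k, phi k != 0 -> exists B, forall k', key k' = key k -> (k' < B)%N) ->
  \sum_(0 <= k < m0.*2) phi (p k) = \sum_(0 <= k < m0.*2) phi k.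
Proof.
move=> Hp Hid Kp Kid fin.
pose S := [seq k <- map p (iota 0 m0.*2) ++ iota 0 m0.*2 | phi k != 0].
pose psi k := if key k \in map key S then phi k else 0.
have [B HB] : exists B, forall k, key k \in map key S -> (k < B)%N.
  have : all (fun k => phi k != 0) S by apply/allP => k; rewrite mem_filter => /andP[].
  elim: S {psi} => [_|k S IH /= /andP[/fin[B1 H1] /IH[B2 H2]]].
    by exists 0%N.
  exists (maxn B1 B2) => k'; rewrite in_cons leq_max => /predU1P[/H1->//|/H2->].
  by rewrite orbT.
have psiE k : k \in map p (iota 0 m0.*2) ++ iota 0 m0.*2 -> psi k = phi k.
  move=> kS; rewrite /psi; case: ifPn => // kN.
  apply/esym/eqP; apply: contraNT kN => nz.
  by apply: map_f; rewrite mem_filter nz.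
have -> : \sum_(0 <= k < m0.*2) phi (p k) = \sum_(0 <= k < m0.*2) psi (p k).
  rewrite big_seq [RHS]big_seq; apply: eq_bigr => k; rewrite /index_iota subn0 => kS.
  by rewrite psiE // mem_cat map_f.
have -> : \sum_(0 <= k < m0.*2) phi k = \sum_(0 <= k < m0.*2) psi k.
  rewrite big_seq [RHS]big_seq; apply: eq_bigr => k; rewrite /index_iota subn0 => kS.
  by rewrite psiE // mem_cat kS orbT.
apply: (@balance_finite psi B).
- by move=> i mi; rewrite /psi Kp //; case: ifP => _; rewrite ?Hp ?addr0.
- by move=> i mi; rewrite /psi Kid //; case: ifP => _; rewrite ?Hid ?addr0.
- by move=> k Bk; rewrite /psi; case: ifP => // /HB; rewrite ltnNge Bk.
Qed.

End Balance.

(** * Rearrangements of a series with separated centres *)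

Section Estimates.
Context {R : realType}.
Implicit Types c e : R.

Lemma min_eighth c e : 0 < c -> 0 < e ->
  exists d : R, [/\ 0 < d, 8 * d <= c & 8 * d <= e].
Proof.
move=> c0 e0; have m0 : 0 < Num.min c e by rewrite lt_min c0.
have h1 : Num.min c e <= c by rewrite ge_min lexx.
have h2 : Num.min c e <= e by rewrite ge_min lexx orbT.
by exists (Num.min c e / 8); split; lra.
Qed.

Lemma three_eighths c e : 0 < e -> 8 * e <= c -> 3 * e <= c.
Proof. lra. Qed.

(** The larger term of a nearly cancelling pair is almost nonnegative, hence so is its centre. *)
Lemma centre_ge (u v c e : R) :
  v <= u -> `|u + v| < e -> `|u - c| < e -> - (2 * e) <= c.
Proof. rewrite !ltr_norml; lra. Qed.

Lemma near_sum (u v c d e : R) :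
  `|u - c| < e -> `|v - d| < e -> `|u + v| < e -> `|c + d| < 3 * e.
Proof. rewrite !ltr_norml; lra. Qed.

Lemma small_of_sum (c d e th : R) : 0 < e -> 8 * e <= th ->
  - (2 * e) <= c -> - (2 * e) <= d -> `|c + d| < 3 * e -> `|c| < th.
Proof. rewrite !ltr_norml; lra. Qed.

Lemma limit_gap (s a e F1 F2 S1 S2 S0 : R) :
  `|F1 + S1 - s| < e / 4 -> `|F2 + S2 - a| < e / 4 ->
  `|S1 - S0| < e / 4 -> `|S2 - S0| < e / 4 -> `|s - a - (F1 - F2)| <= e.
Proof. rewrite !ltr_norml ler_norml; lra. Qed.

End Estimates.

Lemma pair_sums_null {R : realType} (z : nat -> R) (s : R) :
  sum_2n z n @[n --> \oo] --> s ->
  forall e : R, 0 < e -> exists n0, forall n, (n0 <= n)%N ->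
    `|z n.*2 + z n.*2.+1| < e.
Proof.
move=> /cvg_epsP zs e e_gt0; have e2 : 0 < e / 2 by lra.
have [n0 Hn0] := zs _ e2; exists n0 => n n0n.
have h1 := Hn0 n n0n; have := Hn0 n.+1 (leqW n0n).
move: h1; rewrite !sum_2nE big_nat_recr //= !ltr_norml; lra.
Qed.

Section Centers.
Context {R : realType}.
Variables (x : nat -> R) (a : R) (C : nat -> R) (N : nat) (e0 K L : R).
Hypothesis xa : sum_2n x n @[n --> \oo] --> a.
Hypothesis x_le : forall n, x n.*2.+1 <= x n.*2.
Hypothesis y_abs : forall M, \sum_(0 <= n < M) `|x n.*2 + x n.*2.+1| <= L.
Hypothesis e0_gt0 : 0 < e0.
Hypothesis C_sep : forall n m, (N <= n)%N -> (N <= m)%N -> C n != C m ->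
  e0 < `|C n - C m|.
Hypothesis C_abs : forall M, \sum_(N <= n < M) `|x n.*2 - C n| <= K.

Definition recurrent_centers : set R :=
  [set g | forall M, exists n, [/\ (M <= n)%N, (N <= n)%N & C n = g]].

Let E := recurrent_centers.

(** An exactly cancelling model of [x], with pairs [C n], [- C n]. The initial pairs go entirely
    into the remainder [r], which is absolutely summable. *)
Let f k := if (k./2 < N)%N then 0 else if odd k then - C k./2 else C k./2.
Let r k := x k - f k.

Let f_even n : (N <= n)%N -> f n.*2 = C n.
Proof. by move=> Nn; rewrite /f doubleK ltnNge Nn odd_double. Qed.

Let f_odd n : (N <= n)%N -> f n.*2.+1 = - C n.
Proof. by move=> Nn; rewrite /f /= uphalf_double ltnNge Nn odd_double. Qed.

Let r_abs : exists K' : R, forall M, \sum_(0 <= k < M) `|r k| <= K'.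
Proof.
exists (\sum_(0 <= n < N) (`|r n.*2| + `|r n.*2.+1|) + (2 * K + L)) => M.
pose M' := maxn N M.
apply: le_trans (_ : \sum_(0 <= k < M'.*2) `|r k| <= _).
  rewrite [leRHS](@big_cat_nat _ _ _ M) //= ?lerDl ?sumr_ge0 //.
  by rewrite /M'; lia.
have -> : \sum_(0 <= k < M'.*2) `|r k| = \sum_(0 <= n < M') (`|r n.*2| + `|r n.*2.+1|).
  by have := sum_2nE (fun k => `|r k|) M'; rewrite /sum_2n mul2n.
rewrite (@big_cat_nat _ _ _ N 0 M') ?leq_maxl //= lerD2l.
(* The second error [x n.*2.+1 + C n] is the pair sum minus the first error, so first errors count
   twice. *)
apply: le_trans (_ : \sum_(N <= n < M') (2 * `|x n.*2 - C n| + `|x n.*2 + x n.*2.+1|) <= _).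
  rewrite big_nat [leRHS]big_nat; apply: ler_sum => n /andP[Nn _].
  rewrite /r f_even // f_odd // opprK.
  have := ler_normB (x n.*2 + x n.*2.+1) (x n.*2 - C n).
  by rewrite (_ : _ + _ - (_ - _) = x n.*2.+1 + C n); [lra|ring].
rewrite big_split -big_distrr /=; apply: lerD.
  by rewrite ler_pM2l ?C_abs.
apply: le_trans (y_abs M'); rewrite [leRHS](@big_cat_nat _ _ _ N 0 M') ?leq_maxl //=.
by rewrite lerDr sumr_ge0.
Qed.

Let r_null (e : R) : 0 < e -> exists n0, forall k, (n0 <= k)%N -> `|r k| < e.
Proof.
have [K' HK'] := r_abs => e_gt0.
have [n0 Hn0] := summable_tail (fun n => normr_ge0 (r n)) HK' e_gt0.
exists n0 => k nk; apply: le_lt_trans (Hn0 k.+1); rewrite big_nat_recr //=.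
by rewrite lerDr sumr_ge0.
Qed.

Lemma recurrent_pairs_centers : recurrent_pairs x 0 E.
Proof.
move=> g Eg; exists (fun n => (N <= n)%N && (C n == g)); split.
  by move=> M; have [n [Mn Nn Cn]] := Eg M; exists n; rewrite Mn Nn Cn eqxx.
move=> e e_gt0; have [n0 Hn0] := r_null e_gt0; exists n0 => n n0n /andP[Nn /eqP <-].
rewrite !add0n; split.
  by have := Hn0 n.*2; rewrite /r f_even //; apply; lia.
by have := Hn0 n.*2.+1; rewrite /r f_odd // opprK; apply; lia.
Qed.

(** Two distinct centres of absolute value below [e0 / 2] would be closer than [e0]. So at most one
    is that small, and if it is nonzero its absolute value is the threshold. *)
Let C_small : exists2 th : R, 0 < th & forall n, (N <= n)%N -> `|C n| < th -> C n = 0.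
Proof.
have [[n [Nn Cn0 Cn]]|H] :=
  pselect (exists n, [/\ (N <= n)%N, C n != 0 & `|C n| < e0 / 2]).
  exists `|C n|; first by rewrite normr_gt0.
  move=> m Nm mn; have [/eqP//|Cm] := boolP (C m == 0).
  have [e|ne] := eqVneq (C n) (C m); first by rewrite e ltxx in mn.
  have := C_sep Nn Nm ne; have := ler_normB (C n) (C m); lra.
exists (e0 / 2); first by rewrite divr_gt0.
move=> n Nn Cn; have [/eqP//|Cn0] := boolP (C n == 0).
by case: H; exists n.
Qed.

(** The fibres are the classes of pairs with a common centre, together with one finite fibre [None]
    for the first [N] pairs. *)
Let key k : option R := if (k./2 < N)%N then None else Some (C k./2).

Section Rearranged.
Variables (p : nat -> nat) (s : R).
Hypothesis bp : bijective p.
Hypothesis ps : sum_2n (x \o p) n @[n --> \oo] --> s.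

(* Two terms of the same sign can only cancel when both are close to 0, and by
   separation at most one centre is; it must then be exactly 0. *)
Let pairs_cancel : exists m0, forall i, (m0 <= i)%N ->
  f (p i.*2) + f (p i.*2.+1) = 0 /\ key (p i.*2) = key (p i.*2.+1).
Proof.
have [th th0 Hth] := C_small.
have [e [e_gt0 ee0 eth]] := min_eighth e0_gt0 th0.
have [n1 H1] := r_null e_gt0.
have [n2 H2] := pair_sums_null xa e_gt0.
have [n3 H3] := pair_sums_null ps e_gt0.
pose T := maxn (maxn n1 n2) N.
have [n1T n2T NT] : [/\ (n1 <= T)%N, (n2 <= T)%N & (N <= T)%N].
  by rewrite !leq_max !leqnn !orbT.
have C_ge n : (T <= n)%N -> - (2 * e) <= C n.
  move=> Tn; apply: (centre_ge (x_le n) (H2 n (leq_trans n2T Tn))).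
  rewrite -(f_even (leq_trans NT Tn)); apply: H1.
  by rewrite -addnn (leq_trans (leq_trans n1T Tn)) ?leq_addl.
have [m1 Hm1] := bijective_ge T.*2 bp.
exists (maxn n3 m1) => i; rewrite geq_max => /andP[n3i m1i].
have m1i2 : (m1 <= i.*2)%N by rewrite -addnn (leq_trans m1i) ?leq_addl.
have /= := H3 i n3i; have := Hm1 _ m1i2; have := Hm1 _ (leqW m1i2).
move: (p i.*2) (p i.*2.+1) => k k' Tk' Tk xkk'.
have n1k j : (T.*2 <= j)%N -> (n1 <= j)%N.
  by move=> /(leq_trans _); apply; rewrite -addnn (leq_trans n1T) ?leq_addl.
have hs : `|f k + f k'| < 3 * e.
  exact: near_sum (H1 k (n1k _ Tk)) (H1 k' (n1k _ Tk')) xkk'.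
have Th j : (T.*2 <= j)%N -> (T <= j./2)%N by move=> /half_leq; rewrite doubleK.
have [{}Tk {}Tk'] := (Th _ Tk, Th _ Tk').
have [Nk Nk'] := (leq_trans NT Tk, leq_trans NT Tk').
move: hs; rewrite /key /f ![(_ < N)%N]ltnNge Nk Nk' /=.
have zero : `|C k./2 + C k'./2| < 3 * e -> C k./2 = 0 /\ C k'./2 = 0.
  move=> h; split; apply: Hth => //.
    exact: (small_of_sum e_gt0 eth (C_ge _ Tk) (C_ge _ Tk') h).
  by apply: (small_of_sum e_gt0 eth (C_ge _ Tk') (C_ge _ Tk)); rewrite addrC.
have same : `|C k./2 - C k'./2| < 3 * e -> C k./2 = C k'./2.
  move=> h; apply/eqP; apply: contraT => /(C_sep Nk Nk') h'.
  by have := lt_trans h' h; rewrite ltNge (three_eighths e_gt0 ee0).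
case: (odd k); case: (odd k').
- by rewrite -opprD normrN => /zero[-> ->]; rewrite addr0 oppr0.
- by rewrite addrC distrC => /same ->; rewrite subrr.
- by move=> /same ->; rewrite subrr.
- by move=> /zero[-> ->]; rewrite addr0.
Qed.

(** The remainder [r] has the same sum in both orders, and the sums of [f] are constant from [m0]
    pairs on, so only the difference of the latter survives. *)
Let sum_shift m0 : (N <= m0)%N ->
  (forall i, (m0 <= i)%N -> f (p i.*2) + f (p i.*2.+1) = 0) ->
  s - a = \sum_(0 <= k < m0.*2) f (p k) - \sum_(0 <= k < m0.*2) f k.
Proof.
move=> Nm0 Hp; set D := RHS.
have Hid i : (m0 <= i)%N -> f i.*2 + f i.*2.+1 = 0.
  by move=> mi; rewrite f_even ?f_odd ?subrr //; lia.
apply/eqP; rewrite -subr_eq0 -normr_le0; apply/ler_addgt0Pl => e e_gt0; rewrite addr0.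
have e4 : 0 < e / 4 by lra.
have [K' HK'] := r_abs.
have [n0 Hn0] := summable_tail (fun n => normr_ge0 (r n)) HK' e4.
have [n1 H1] := summable_rearrangement bp Hn0.
have bid : bijective (@id nat) by exists id.
have [n2 H2] := summable_rearrangement bid Hn0.
move/cvg_epsP: ps => /(_ _ e4)[n3 H3]; move/cvg_epsP: xa => /(_ _ e4)[n4 H4].
pose m := maxn (maxn m0 (maxn n1 n2)) (maxn n3 n4).
have [m0m n1m n2m n3m n4m] :
    [/\ (m0 <= m)%N, (n1 <= m)%N, (n2 <= m)%N, (n3 <= m)%N & (n4 <= m)%N].
  by rewrite /m !leq_max !leqnn !orbT.
have dbl n : (n <= m)%N -> (n <= m.*2)%N.
  by move=> nm; rewrite -addnn (leq_trans nm) ?leq_addl.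
have split_x q : sum_2n (x \o q) m =
    \sum_(0 <= k < m.*2) f (q k) + \sum_(0 <= k < m.*2) r (q k).
  rewrite /sum_2n mul2n -big_split; apply: eq_bigr => k _ /=.
  by rewrite /r addrC subrK.
have := H3 m n3m; rewrite split_x (cancelling_pairs Hp m0m) => h3.
have := H4 m n4m; rewrite -[x]/(x \o id) split_x.
rewrite (@cancelling_pairs _ m0 f id Hid m m0m) => h4.
exact: limit_gap h3 h4 (H1 _ (dbl _ n1m)) (H2 _ (dbl _ n2m)).
Qed.

(** The difference [s - a] is a finite signed sum of centres. Those outside [E] have finite classes
    and balance out; counting modulo 2 shows that the remaining summands are even in number. *)
Lemma rearranged_sum : exists l : seq R,
  [/\ forall g, g \in l -> E g \/ E (- g), ~~ odd (size l) &
      s = a + \sum_(g <- l) g].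
Proof.
have [m1 Hm1] := pairs_cancel.
pose m0 := (m1 + N)%N.
have Hp i : (m0 <= i)%N -> f (p i.*2) + f (p i.*2.+1) = 0.
  by move=> mi; have [] := Hm1 i ltac:(move: mi; rewrite /m0; lia).
have Kp i : (m0 <= i)%N -> key (p i.*2) = key (p i.*2.+1).
  by move=> mi; have [] := Hm1 i ltac:(move: mi; rewrite /m0; lia).
have Hid i : (m0 <= i)%N -> f i.*2 + f i.*2.+1 = 0.
  by move=> mi; rewrite f_even ?f_odd ?subrr //; move: mi; rewrite /m0; lia.
have Kid i : (m0 <= i)%N -> key i.*2 = key i.*2.+1.
  by move=> mi; rewrite /key /= uphalf_double doubleK.
pose kE (o : option R) := if o is Some g then `[< E g >] else false.
pose inE k := kE (key k).
have fib k : ~~ inE k -> exists B, forall k', key k' = key k -> (k' < B)%N.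
  rewrite /inE /key; case: ifP => [_ _|_ /= /asboolPn nE].
    by exists N.*2 => k'; case: ltnP => // h _; lia.
  have /existsNP[M HM] : ~ forall M, exists n, [/\ (M <= n)%N, (N <= n)%N & C n = C k./2].
    exact: nE.
  exists M.*2 => k'; case: ltnP => // Nk' [e].
  by rewrite ltnNge; apply/negP => Mk'; case: HM; exists k'./2; split=> //; lia.
pose fN k := if inE k then 0 else f k.
have SN : \sum_(0 <= k < m0.*2) fN (p k) = \sum_(0 <= k < m0.*2) fN k.
  apply: (@balance_finite_fibres _ _ _ bp _ key).
  - by move=> i mi; rewrite /fN /inE Kp //; case: ifP => _; rewrite ?addr0 ?Hp.
  - by move=> i mi; rewrite /fN /inE Kid //; case: ifP => _; rewrite ?addr0 ?Hid.
  - exact: Kp.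
  - exact: Kid.
  - by move=> k; rewrite /fN; case: ifP => [|/negbT /fib //]; rewrite eqxx.
(* [bool] serves as the group of order two, so the same balance holds for the parity of the number
   of terms outside [E]. *)
have PN : (\sum_(0 <= k < m0.*2) (~~ inE (p k) : bool) =
           \sum_(0 <= k < m0.*2) (~~ inE k : bool) :> bool)%R.
  apply: (@balance_finite_fibres _ _ _ bp _ key (fun k => ~~ inE k)).
  - by move=> i mi; rewrite /inE Kp //; case: (kE _).
  - by move=> i mi; rewrite /inE Kid //; case: (kE _).
  - exact: Kp.
  - exact: Kid.
  - by move=> k nz; apply: fib; move: nz; case: (inE k).
pose l1 := [seq f (p k) | k <- iota 0 m0.*2 & inE (p k)].
pose l2 := [seq - f k | k <- iota 0 m0.*2 & inE k].
exists (l1 ++ l2); split.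
- have fE k : inE k -> E (f k) \/ E (- f k).
    rewrite /inE /key /f; case: ifP => // _ /asboolP Ek.
    by case: (odd k); rewrite ?opprK; [right|left].
  move=> g; rewrite mem_cat => /orP[] /mapP[k]; rewrite mem_filter => /andP[kE' _] ->.
    exact: fE.
  by rewrite opprK; have [] := fE k kE'; [right|left].
- have odd_count (b : pred nat) n :
      odd (count b (iota 0 n)) = (\sum_(0 <= k < n) (b k : bool))%R.
    rewrite -sum1_count big_mkcond /= (big_morph odd oddD (erefl (odd 0))).
    rewrite /index_iota subn0; apply: eq_bigr => k _; by case: (b k).
  (* Since [m0.*2] is even, terms inside and outside [E] have counts of equal parity. *)
  have odd_inE (b : pred nat) : odd (count b (iota 0 m0.*2)) =
      odd (count (predC b) (iota 0 m0.*2)).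
    have := count_predC b (iota 0 m0.*2); rewrite size_iota => /(congr1 odd).
    by rewrite oddD odd_double; case: odd; case: odd.
  rewrite size_cat !size_map !size_filter oddD (odd_inE (fun k => inE (p k))) (odd_inE inE).
  by rewrite !odd_count /= PN addbb.
- rewrite -[LHS](subrK a) addrC; congr (_ + _)%R.
  rewrite (@sum_shift m0) //; last by rewrite /m0; lia.
  have split_f q : \sum_(0 <= k < m0.*2) f (q k) =
      \sum_(0 <= k < m0.*2) fN (q k) + \sum_(0 <= k < m0.*2 | inE (q k)) f (q k).
    rewrite [X in _ = _ + X]big_mkcond -big_split /=; apply: eq_bigr => k _.
    by rewrite /fN; case: ifP; rewrite ?add0r ?addr0.
  rewrite big_cat /l1 /l2 !big_map !big_filter sumrN (split_f p) (split_f id) SN.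
  by rewrite /index_iota subn0 opprD addrACA subrr add0r.
Qed.

End Rearranged.
End Centers.

(** * The even sum range *)

Section SignedSums.
Context {R : realType}.
Variable E : set R.

(** Multiplicities are expressed by repetition, so the length of the list has the parity of the sum
    of the coefficients. *)
Definition signed_sum (b : bool) (s : R) : Prop := exists l : seq R,
  [/\ forall g, g \in l -> E g \/ E (- g), odd (size l) = b & s = \sum_(g <- l) g].

Let signed_sum0 : signed_sum false 0.
Proof. by exists [::]; split=> //; rewrite big_nil. Qed.

Let signed_sum1 s : E s \/ E (- s) -> signed_sum true s.
Proof.
by move=> Es; exists [:: s]; split=> //; [move=> g; rewrite inE => /eqP->|rewrite big_seq1].
Qed.

Let signed_sumD b1 b2 s1 s2 :
  signed_sum b1 s1 -> signed_sum b2 s2 -> signed_sum (b1 (+) b2) (s1 + s2).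
Proof.
move=> [l1 [h1 <- ->]] [l2 [h2 <- ->]]; exists (l1 ++ l2); split.
- by move=> g; rewrite mem_cat => /orP[/h1|/h2].
- by rewrite size_cat oddD.
- by rewrite big_cat.
Qed.

Let signed_sumMn n s : E s \/ E (- s) -> signed_sum (odd n) (s *+ n).
Proof.
move=> Es; elim: n => [|n IH]; first by rewrite mulr0n.
by rewrite mulrS -[odd _]/(~~ odd n) -addTb; apply: signed_sumD => //; exact: signed_sum1.
Qed.

Lemma even_combinationsP g0 s : E g0 ->
  even_combinations E s <-> signed_sum false s.
Proof.
move=> Eg0; split.
  move=> [l [z [c [_ Ez ev ->]]]].
  suff H : signed_sum (~~ (2 %| \sum_(k < l) c k)%Z) (\sum_(k < l) (c k)%:~R * z k).
    by rewrite ev in H.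
  elim/big_ind2: _ => [|c1 s1 c2 s2 h1 h2|k _].
  - by rewrite dvdz0.
  - have := signed_sumD h1 h2; congr (signed_sum _ _); lia.
  - rewrite mulrzl; case: (c k) => n.
      have := signed_sumMn n (or_introl (Ez k)); congr (signed_sum _ _); lia.
    have Ez' : E (- z k) \/ E (- - z k) by right; rewrite opprK.
    have := signed_sumMn n.+1 Ez'; congr (signed_sum _ _); first by lia.
    by rewrite NegzE mulrNz mulNrn.
move=> [[|g l] [lE ev ->]].
  (* [even_combinations] asks for at least one summand, so the empty list becomes [0 * g0]. *)
  exists 1%N, (fun=> g0), (fun=> 0); split=> //; first by rewrite big1.
  by rewrite big_nil big1 // => k _; rewrite mul0r.
move: (g :: l) lE ev (isT : 0 < size (g :: l))%N => {g}l lE ev sz.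
(* An entry [h] outside [E] is written as [- 1] times [- h], which is in [E]. *)
pose sg (h : R) : int := if `[< E h >] then 1 else -1.
exists (size l), (fun k => (sg (tnth (in_tuple l) k))%:~R * tnth (in_tuple l) k),
  (fun k => sg (tnth (in_tuple l) k)).
split=> //.
- move=> k; rewrite /sg; case: asboolP => nE; first by rewrite mul1r.
  by rewrite mulN1r; have [] := lE _ (mem_tnth k (in_tuple l)).
- rewrite -(big_tnth _ _ l xpredT sg).
  have : (2 %| \sum_(h <- l) sg h + (size l)%:Z)%Z; last first.
    move: ev; move: (\sum_(h <- l) sg h) (size l) => S n ev h.
    by move: ev h; lia.
  elim: l {lE ev sz} => [|h l IH]; first by rewrite big_nil.
  rewrite big_cons /=; move: IH.
  move: (\sum_(j <- l) sg j) (size l) => S n IH; have : sg h = 1 \/ sg h = -1.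
    by rewrite /sg; case: asboolP => _; [left|right].
  by case=> ->; lia.
- rewrite (big_nth 0) big_mkord; apply: eq_bigr => k _.
  rewrite (tnth_nth 0) /= mulrA -intrM /sg.
  by case: asboolP; rewrite ?mulr1 ?mulrNN ?mulr1 mul1r.
Qed.

End SignedSums.

(** * Reduction to ordered pairs and the three cases *)

Lemma sort_pairs {R : realType} (x : nat -> R) : exists2 q : nat -> nat,
  bijective q & (forall n, x (q n.*2.+1) <= x (q n.*2)) /\
                (forall n, sum_2n (x \o q) n = sum_2n x n).
Proof.
pose q k := if x k./2.*2 < x k./2.*2.+1 then flip 0 k else k.
have q_even n : q n.*2 = if x n.*2 < x n.*2.+1 then n.*2.+1 else n.*2.
  by rewrite /q doubleK; case: ifP => // _; exact: (flip_even 0 n).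
have q_odd n : q n.*2.+1 = if x n.*2 < x n.*2.+1 then n.*2 else n.*2.+1.
  by rewrite /q /= uphalf_double; case: ifP => // _; exact: (flip_odd 0 n).
exists q; last split.
- suff qK : involutive q by exists q.
  move=> k; rewrite -[k]odd_double_half; case: (odd k); rewrite ?add1n ?add0n.
    by rewrite q_odd; case: ifP => h; rewrite ?q_even ?q_odd h.
  by rewrite q_even; case: ifP => h; rewrite ?q_even ?q_odd h.
- by move=> n; rewrite q_even q_odd; case: ltP => // /ltW.
- move=> n; rewrite !sum_2nE; apply: eq_bigr => i _ /=; rewrite q_even q_odd.
  by case: ifP => // _; rewrite addrC.
Qed.

Lemma SR2_id {R : realType} (x : nat -> R) (a : R) :
  sum_2n x n @[n --> \oo] --> a -> SR2 x a.
Proof. by move=> xa; exists id => //; exists id. Qed.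

Theorem theorem3p1p3 (R : realType) (x : nat -> R) (a : R)
    (hx : sum_2n x n @[n --> \oo] --> a) :
  [\/ exists (eps : R) (E : set R),
        [/\ 0 < eps, eps_separated eps E &
            SR2 x = [set a + g | g in even_combinations E]],
      SR2 x = setT |
      SR2 x = [set a]].
Proof.
have [q bq [q_le q_sum]] := sort_pairs x.
rewrite -(SR2_comp x bq); set z := x \o q.
have {hx q_sum} za : sum_2n z n @[n --> \oo] --> a.
  by under eq_fun do rewrite q_sum.
have {q_le} z_le n : z n.*2.+1 <= z n.*2 := q_le n.
move: z za z_le => {q bq}z za z_le {x}.
pose y n := z n.*2 + z n.*2.+1.
have y_null (e : R) : 0 < e -> exists N, forall n, (N <= n)%N -> `|y n| < e.
  exact: pair_sums_null za e.
have [[L y_abs]|y_unb] := pselect (exists L : R, forall M, \sum_(0 <= n < M) `|y n| <= L);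
  last first.
  constructor 2; apply: SR2_setT => s.
  have [N HN] := (cvg_epsP _ _).1 za 1 ltr01.
  apply: (riemann_rearrangement (y := y) (K := `|a| + 1) s) => // B.
  move/forallNP: y_unb => y_unb.
  (* Taking the maximum forces [N <= M], where the partial sum is within 1 of [a]. *)
  have /existsNP[M HM] := y_unb (Num.max B (\sum_(0 <= n < N) `|y n|)).
  move/negP: HM; rewrite -ltNge gt_max => /andP[BM NM]; exists M; split; last exact: ltW.
  have {}NM : (N <= M)%N.
    rewrite leqNgt; apply/negP => /ltnW MN; move: NM; apply/negP; rewrite -leNgt.
    by rewrite [leRHS](@big_cat_nat _ _ _ M 0 N) //= lerDl sumr_ge0.
  have := HN M NM; rewrite sum_2nE -/y => h.
  by rewrite -lerBlDl (le_trans (lerB_dist _ _)) // ltW.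
pose u n := z n.*2.
have [moves|no_moves] := pselect (forall d : R, 0 < d -> exists2 eta : R, 0 < eta &
    forall N, exists M f, is_move u d N M f /\ eta <= move_total u M f).
  constructor 2.
  have [|t [tK t_null t_unb]] := @infinite_move R u.
    move=> d d0 N; have [eta eta0 /moves_unbounded H] := moves d d0.
    have [M [f [NM mf tf]]] := H (Num.trunc eta^-1).+1 N.
    exists M, f; split=> //; apply: le_trans tf; rewrite -mulr_natr.
    by rewrite -ler_pdivrMl // mulr1 ltW // truncnS_gt.
  exact: (@SR2_setT_of_moves R z L t).
have /existsNP[d /not_implyP[d0 Hd]] := no_moves.
have [|C [N [e [K [e0 C_sep C_abs]]]]] := @separated_centers R u d d0.
  move=> eta eta0; apply: contrapT => /forallNP H; apply: Hd; exists eta => // N.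
  have /existsNP[M /existsNP[f /not_implyP[mf tf]]] := H N.
  by exists M, f; split=> //; rewrite leNgt; apply/negP.
pose E := recurrent_centers C N.
have sub s : SR2 z s -> exists2 g, signed_sum E false g & s = a + g.
  move=> [p bp ps].
  have [l [lE ev ->]] := rearranged_sum za z_le y_abs e0 C_sep C_abs bp ps.
  by exists (\sum_(g <- l) g) => //; exists l; split=> //; apply/negbTE.
have sup g : signed_sum E false g -> SR2 z (a + g).
  move=> [l [lE ev ->]]; apply: (SR2_add_terms lE) => //; first by rewrite ev.
  exact: recurrent_pairs_centers C_abs.
(* A nonempty [E] supplies the [g0] of [even_combinationsP]; with [E] empty only the empty list
   remains, which gives the sum [a] alone. *)
have [[g0 Eg0]|E0] := pselect (exists g0, E g0).
  constructor 1; exists e, E; split=> //.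
    move=> g h Eg Eh; have [n [_ Nn <-]] := Eg 0%N; have [m [_ Nm <-]] := Eh 0%N.
    exact: C_sep.
  apply/seteqP; split=> [s /sub[g Eg ->]|s [g /(even_combinationsP _ Eg0) Eg <-]].
    by exists g => //; apply/(even_combinationsP _ Eg0).
  exact: sup.
constructor 3; apply/seteqP; split=> [s /sub[g [[|h l] [lE _ ->]] ->]|_ ->].
- by rewrite big_nil addr0.
- by have [] := lE h (mem_head _ _) => Eh; case: E0; eexists; exact: Eh.
- exact: SR2_id.
Qed.
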